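(* Let $G=(V,E)$ be an indecomposable graph with $n:=v(G)\geq 14$. Then for all $a\neq b\in V$, one of the following assertions is satisfied. (1) There is $X\subset V$ such that $a,b\in X$, $|X|=n-2$ and $G[X]$ is indecomposable. (2) There is an isomorphism $f$ from $G$ or $\overline{G}$ onto an element of $\mathcal{P}\cup\mathcal{Q}$ such that $f(\{a,b\})=\{1,n\}$. (3) There are $k\in\{1,3,5\}$ and an isomorphism $f$ from $G$ or $\overline{G}$ onto an element of $\mathcal{P}_{-k}\cup\mathcal{Q}_{-k}$ such that $f(\{a,b\})=\{1,n-k\}$.
   Context: Graphs are finite, simple and undirected; $v(G)=|V(G)|$, $\overline{G}$ is the complement of $G$, $G[X]$ is the subgraph induced by $X$, $G-X=G[V(G)\setminus X]$. A subset $I\subseteq V(G)$ is an interval of $G$ if every vertex outside $I$ is adjacent to all or to none of the vertices of $I$. The sets $\emptyset$, $V(G)$ and $\{x\}$ ($x\in V(G)$) are the trivial intervals. $G$ is indecomposable if all its intervals are trivial. For an indecomposable graph $G=(V,E)$, the indecomposability graph $\mathbb{I}(G)$ has vertex set $V$, and its edges are the pairs $\{x,y\}$ of distinct vertices such that $G-\{x,y\}$ is indecomposable. A graph $H$ is $X$-covered, for $X\subseteq V(H)$, if every edge of $H$ meets $X$. Let $\mathbb{N}_n=\{1,\dots,n\}$. For $n\ge 1$, $P_n$ is the graph on $\mathbb{N}_n$ in which $i\ne j$ are adjacent iff $|i-j|=1$. For $n\geq 4$, $Q_n$ is the graph on $\mathbb{N}_n$ with edge set $E(P_{n-2})\cup\{\{n-1,i\}: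 i\in\mathbb{N}_n\setminus\{n-1,n-2\}\}$. Let $\mathcal{P}=\{P_n:n\ge 9\}$ and $\mathcal{Q}=\{Q_n:n\geq 9\}$. For $k\in\{1,3,5\}$, $\mathcal{P}_{-k}$ (resp. $\mathcal{Q}_{-k}$) is the set of indecomposable graphs $G$ with vertex set $\mathbb{N}_n$ such that $\mathbb{I}(G)$ is $\{1,n-k\}$-covered and $G-\{n-k+1,\dots,n\}=P_{n-k}$ (resp. $=Q_{n-k}$), where $n$ ranges over: $n\geq 9$ for $\mathcal{P}_{-1}$, $n\geq 12$ for $\mathcal{P}_{-3}$, $n\geq 14$ for $\mathcal{P}_{-5}$, $n\geq 11$ for $\mathcal{Q}_{-1}$, $n\geq 10$ for $\mathcal{Q}_{-3}$, $n\geq 12$ for $\mathcal{Q}_{-5}$. *)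

(* Defs.v *)
From mathcomp Require Import all_boot.

Set Implicit Arguments.
Unset Strict Implicit.
Unset Printing Implicit Defensive.

Record sgraph (V : finType) := SGraph {
  adj :> rel V;
  adj_sym : symmetric adj;
  adj_irr : irreflexive adj }.

Section Graphs.
Variable V : finType.
Implicit Types (G : sgraph V) (I X : {set V}).

Definition compl_rel G : rel V := fun x y => (x != y) && ~~ G x y.

Lemma compl_rel_sym G : symmetric (compl_rel G).
Proof. by move=> x y; rewrite /compl_rel eq_sym adj_sym. Qed.

Lemma compl_rel_irr G : irreflexive (compl_rel G).
Proof. by move=> x; rewrite /compl_rel eqxx. Qed.

Definition complement G := SGraph (@compl_rel_sym G) (@compl_rel_irr G).

Definition interval G I :=
  [forall (x | x \notin I), [forall y in I, G x y] || [forall y in I, ~~ G x y]].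

Definition trivial_interval I :=
  [|| I == set0, I == [set: V] | [exists x, I == [set x]]].

Definition indecomposable G :=
  [forall I, interval G I ==> trivial_interval I].

Definition covered G X :=
  [forall x, forall y, G x y ==> (x \in X) || (y \in X)].

End Graphs.

Section Pullback.
Variables (U V : finType) (f : U -> V) (G : sgraph V).

Definition pullback_rel : rel U := fun x y => G (f x) (f y).

Lemma pullback_rel_sym : symmetric pullback_rel.
Proof. by move=> x y; rewrite /pullback_rel adj_sym. Qed.

Lemma pullback_rel_irr : irreflexive pullback_rel.
Proof. by move=> x; rewrite /pullback_rel adj_irr. Qed.

Definition pullback := SGraph pullback_rel_sym pullback_rel_irr.

End Pullback.

Definition isomorphism (U V : finType) (G : sgraph U) (H : sgraph V)
    (f : U -> V) :=
  bijective f /\ forall x y, H (f x) (f y) = G x y.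

Definition induced (V : finType) (G : sgraph V) (X : {set V}) :
    sgraph {x : V | x \in X} :=
  pullback val G.

Section Indecomposability.
Variables (V : finType) (G : sgraph V).

Definition indec_rel : rel V := fun x y =>
  (x != y) && indecomposable (induced G (~: [set x; y])).

Lemma indec_rel_sym : symmetric indec_rel.
Proof. by move=> x y; rewrite /indec_rel eq_sym setUC. Qed.

Lemma indec_rel_irr : irreflexive indec_rel.
Proof. by move=> x; rewrite /indec_rel eqxx. Qed.

Definition indec_graph := SGraph indec_rel_sym indec_rel_irr.

End Indecomposability.

(* The vertex set {1, ..., n} is represented by 'I_n, where i : 'I_n carries
   the label i.+1; the adjacency relations below are written on labels. *)
Definition label n (i : 'I_n) : nat := i.+1.

Definition labelled n (s : seq nat) : {set 'I_n} := [set i | label i \in s].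

Definition path_adj (i j : nat) := (j == i.+1) || (i == j.+1).

Definition path_rel n : rel 'I_n := fun i j => path_adj (label i) (label j).

Lemma path_rel_sym n : symmetric (@path_rel n).
Proof. by move=> i j; rewrite /path_rel /path_adj orbC. Qed.

Lemma path_rel_irr n : irreflexive (@path_rel n).
Proof. by move=> i; rewrite /path_rel /path_adj orbb; elim: (label i). Qed.

Definition P_graph n := SGraph (@path_rel_sym n) (@path_rel_irr n).

(* Q_n is meaningful for n >= 4 only; smaller values are never used. *)
Definition Q_adj n (i j : nat) :=
  [|| [&& i <= n - 2, j <= n - 2 & path_adj i j],
      (i == n - 1) && (j \notin [:: n - 1; n - 2])
    | (j == n - 1) && (i \notin [:: n - 1; n - 2])].

Definition Q_rel n : rel 'I_n := fun i j => Q_adj n (label i) (label j).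

Lemma Q_rel_sym n : symmetric (@Q_rel n).
Proof.
move=> i j; rewrite /Q_rel /Q_adj /path_adj andbCA.
by congr (_ || _); rewrite orbC.
Qed.

Lemma Q_rel_irr n : irreflexive (@Q_rel n).
Proof.
move=> i; rewrite /Q_rel /Q_adj (path_rel_irr i : path_adj _ _ = false).
by rewrite !andbF orbb inE; case: eqP.
Qed.

Definition Q_graph n := SGraph (@Q_rel_sym n) (@Q_rel_irr n).

Definition class_P n (H : sgraph 'I_n) := 9 <= n /\ H =2 P_graph n.
Definition class_Q n (H : sgraph 'I_n) := 9 <= n /\ H =2 Q_graph n.

(* H - {n-k+1, ..., n}: widen_ord preserves labels, so the remaining vertices
   1, ..., n-k form 'I_(n - k). *)
Definition delete_last k n (H : sgraph 'I_n) : sgraph 'I_(n - k) :=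
  pullback (widen_ord (leq_subr k n)) H.

Definition minus_P_range k n :=
  match k with 1 => 9 <= n | 3 => 12 <= n | 5 => 14 <= n | _ => false end.

Definition minus_Q_range k n :=
  match k with 1 => 11 <= n | 3 => 10 <= n | 5 => 12 <= n | _ => false end.

Definition class_P_minus k n (H : sgraph 'I_n) :=
  [/\ minus_P_range k n,
      indecomposable H,
      covered (indec_graph H) (labelled n [:: 1; n - k]) &
      delete_last k H =2 P_graph (n - k)].

Definition class_Q_minus k n (H : sgraph 'I_n) :=
  [/\ minus_Q_range k n,
      indecomposable H,
      covered (indec_graph H) (labelled n [:: 1; n - k]) &
      delete_last k H =2 Q_graph (n - k)].

(* Main.v *)
Require Import Defs.
From mathcomp Require Import all_boot zify.

Set Implicit Arguments.
Unset Strict Implicit.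
Unset Printing Implicit Defensive.

(* Let [Y] be a set containing [a] and [b] and inducing some [P_m] or [Q_m], or
   the complement of one, with [a] and [b] as first and last vertex. Such a [Y]
   exists: up to complement and exchange, [a] and [b] are not adjacent and some
   [x] is adjacent to [a] only. Since the only interval containing [a] and [x]
   is [V], a chain of vertices, each separating its predecessor from all earlier
   ones, leads from [{a, x}] to [b]; an induced path inside the chain gives
   [P_m] or [Q_m] according to whether the vertex before [b] misses or sees [a].

   By the theorem of Ehrenfeucht and Rozenberg, indecomposable sets grow by two
   vertices at a time, so (1) holds if [n - m] is even and positive. If [n - m]
   is odd and at least 7 while no indecomposable proper superset of [Y] has even
   codimension, consider the graph on the complement of [Y] whose edges are the
   pairs that extend [Y] to an indecomposable set: its components are half
   graphs, hence it has evenly many vertices, a contradiction. In the remaining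
   cases [n - m] is 0, 1, 3 or 5, which is (2) or (3) if (1) fails: an edge of
   the indecomposability graph avoiding [a] and [b] would give (1). *)

(** * Intervals, twins and indecomposability of vertex subsets *)

Section InducedIntervals.
Variables (V : finType) (e : rel V).
Hypothesis e_sym : symmetric e.
Implicit Types (X Y S I : {set V}) (u v x y z : V).

(* [I] need not be contained in [X]: the condition says that [X :&: I] is an
   interval of the graph induced on [X]. *)
Definition intv X I :=
  [forall x in X :\: I, forall y in X :&: I, forall z in X :&: I,
    e x y == e x z].

Lemma intvP X I : reflect
  (forall x y z, x \in X -> x \notin I -> y \in X -> y \in I ->
     z \in X -> z \in I -> e x y = e x z) (intv X I).
Proof.
apply: (iffP forall_inP) => [h x y z xX xI yX yI zX zI | h x].
  have /forall_inP/(_ y) := h x ltac:(by rewrite inE xI xX).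
  rewrite inE yX yI => /(_ isT)/forall_inP/(_ z).
  by rewrite inE zX zI => /(_ isT)/eqP.
rewrite inE => /andP[xI xX]; apply/forall_inP => y.
rewrite inE => /andP[yX yI]; apply/forall_inP => z.
by rewrite inE => /andP[zX zI]; apply/eqP/h.
Qed.

Definition indec X :=
  [forall I, intv X I ==> (#|X :&: I| <= 1) || (X \subset I)].

Lemma indecP X : reflect
  (forall I y z, intv X I -> y \in X -> y \in I -> z \in X -> z \in I ->
     y != z -> X \subset I) (indec X).
Proof.
apply: (iffP forallP) => [h I y z hI yX yI zX zI yz | h I].
  have := h I; rewrite hI /= => /orP[/card_le1_eqP h1|//].
  by case/eqP: yz; apply: h1; rewrite inE ?yX ?zX.
apply/implyP => hI; case: leqP => //= /card_gt1P[y [z []]].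
by rewrite !inE => /andP[yX yI] /andP[zX zI]; apply: h.
Qed.

(** Neither [y] nor [z] need lie in [X]: [{y, z}] is an interval of the graph induced on [X]
    together with [y] and [z]. *)
Definition twins X y z := forall v, v \in X -> v != y -> v != z -> e v y = e v z.

(** For [x] outside [X], this says that [X] is an interval of [x |: X]. *)
Definition uniform X x := forall u v, u \in X -> v \in X -> e x u = e x v.

Lemma twinsP X y z : reflect (twins X y z)
  [forall v in X, (v != y) ==> (v != z) ==> (e v y == e v z)].
Proof.
apply: (iffP forall_inP) => h v vX => [vy vz|]; last first.
  by apply/implyP=> vy; apply/implyP=> vz; apply/eqP/h.
by have := h v vX; rewrite vy vz => /eqP.
Qed.

Lemma uniformP X x : reflect (uniform X x)
  [forall u in X, forall v in X, e x u == e x v].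
Proof.
apply: (iffP forall_inP) => h u => [v uX vX|uX].
  by have /forall_inP/(_ v vX)/eqP := h u uX.
by apply/forall_inP=> v vX; apply/eqP/h.
Qed.

Lemma twins_sub X Y y z : X \subset Y -> twins Y y z -> twins X y z.
Proof. by move=> /subsetP XY h v /XY; apply: h. Qed.

Lemma twinsC X y z : twins X y z -> twins X z y.
Proof. by move=> h v vX vz vy; rewrite h. Qed.

Lemma uniform_sub X Y x : X \subset Y -> uniform Y x -> uniform X x.
Proof. by move=> /subsetP XY h u v /XY uY /XY; apply: h. Qed.

Lemma intv_sub X Y I : X \subset Y -> intv Y I -> intv X I.
Proof.
move=> /subsetP XY /intvP h; apply/intvP => x y z xX xI yX yI zX zI.
by apply: h; rewrite ?XY.
Qed.

Lemma mem_neq X v z : z \notin X -> v \in X -> v != z.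
Proof. by move=> zX vX; apply: contraNneq zX => <-. Qed.

Lemma card3_third X y z : 2 < #|X| -> exists2 w, w \in X & (w != y) && (w != z).
Proof.
move=> c3; have : 0 < #|X :\: [set y; z]|.
  have := cardsD X [set y; z].
  have := subset_leq_card (subsetIr X [set y; z]).
  by rewrite cards2; case: (y != z) => /=; lia.
by case/card_gt0P=> w; rewrite !inE negb_or => /andP[? ?]; exists w.
Qed.

Lemma indec_no_twins X y z : indec X -> 2 < #|X| -> y \in X -> z \in X ->
  y != z -> ~ twins X y z.
Proof.
move=> /indecP iX c3 yX zX yz tyz.
have [w wX /andP[wy wz]] := card3_third y z c3.
have /subsetP/(_ w wX) : X \subset [set y; z].
  apply: (iX _ y z) => //; rewrite ?inE ?eqxx ?orbT //.
  apply/intvP => x s t xX; rewrite !inE negb_or => /andP[xy xz] _.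
  by case/orP=> /eqP-> _ /orP[]/eqP->; rewrite ?(tyz x).
by rewrite !inE (negPf wy) (negPf wz).
Qed.

Lemma indec_not_uniform X x : indec X -> 2 < #|X| -> x \in X ->
  ~ uniform (X :\ x) x.
Proof.
move=> /indecP iX c3 xX ux.
have [w wX /andP[wx _]] := card3_third x x c3.
have [t tX /andP[tx tw]] := card3_third x w c3.
(* This set stands for the interval [X :\ x], since [intv] looks only at the trace on [X]. *)
have /subsetP/(_ x xX) : X \subset ~: [set x].
  apply: (iX _ w t) => //; rewrite ?inE // 1?eq_sym //.
  apply/intvP => y s r _; rewrite !inE negbK => /eqP-> sX sx rX rx.
  by apply: ux; rewrite !inE ?sx ?rx.
by rewrite !inE eqxx.
Qed.

Lemma ext_not_uniform X z : 2 < #|X| -> z \notin X -> indec (z |: X) -> ~ uniform X z.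
Proof.
move=> c3 zX iz uz; apply: (indec_not_uniform iz (x := z)); rewrite ?setU11 //.
  by rewrite cardsU1 zX; lia.
by apply: uniform_sub uz; rewrite subDset.
Qed.

Lemma ext_not_twins X z u : 2 < #|X| -> u \in X -> z \notin X -> indec (z |: X) ->
  ~ twins X u z.
Proof.
move=> c3 uX zX iz tz; apply: (indec_no_twins iz (y := u) (z := z)).
- by rewrite cardsU1 zX; lia.
- by rewrite setU1r.
- by rewrite setU11.
- exact: mem_neq uX.
- by move=> v; rewrite !inE => /orP[/eqP->|vX vu vz]; [rewrite eqxx | apply: tz].
Qed.

(** * Extensions of an indecomposable set by one or two vertices *)

Section Extensions.
Variable X : {set V}.
Hypotheses (iX : indec X) (c3 : 2 < #|X|).

(** A nontrivial interval of [x |: X] has as trace on [X] an interval of [X]. If the trace is all of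
    [X], then [x] is uniform; if it has at most one vertex, the interval is [x] with a twin of [x].
    Being uniform, or being a twin of a given [u], are the classes of outside vertices; the next two
    lemmas show that they are disjoint. *)
Lemma ext_class x : x \notin X -> ~~ indec (x |: X) ->
  uniform X x \/ exists2 u, u \in X & twins X u x.
Proof.
move=> xX /forallPn[I]; rewrite negb_imply negb_or -ltnNge.
case/and3P=> hI /card_gt1P[y [z [yI zI yz]]] nsub.
have hX : intv X I by apply: intv_sub hI; apply: subsetU1.
have /forallP/(_ I) := iX; rewrite hX /= => /orP[c1|XI].
  right; have xI : x \in I.
    apply: contraLR yz => xI; rewrite negbK; apply/eqP.
    move/card_le1_eqP: c1; apply.
      by move: zI; rewrite !inE => /andP[/orP[/eqP->|->] //]; rewrite (negPf xI).
    by move: yI; rewrite !inE => /andP[/orP[/eqP->|->] //]; rewrite (negPf xI).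
  have [u uI ux] : exists2 u, u \in (x |: X) :&: I & u != x.
    case: (eqVneq y x) => [yx|]; last by exists y.
    by exists z => //; rewrite -yx eq_sym.
  move: uI; rewrite !inE (negPf ux) /= => /andP[uX uI].
  exists u => // v vX vu vx; move/intvP: hI; apply; rewrite ?inE ?vX ?uX ?eqxx ?orbT //.
  apply/negP=> vI; case/eqP: vu; move/card_le1_eqP: c1; apply; by rewrite inE ?vX ?uX.
left => u v uX vX.
have xI : x \notin I by apply: contra nsub => xI; rewrite subUset sub1set xI.
move/intvP: hI; apply; rewrite ?inE ?uX ?vX ?eqxx ?orbT //; exact: (subsetP XI).
Qed.

Lemma twins_uniq u v x : u \in X -> v \in X -> x \notin X ->
  twins X u x -> twins X v x -> u = v.
Proof.
move=> uX vX xX tu tv; apply/eqP; apply: contraT => uv.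
case: (indec_no_twins iX c3 uX vX uv) => w wX wu wv.
have wx : w != x by apply: contraNneq xX => <-.
by rewrite tu // tv.
Qed.

Lemma uniform_not_twins u x : u \in X -> x \notin X -> uniform X x -> ~ twins X u x.
Proof.
move=> uX xX ux tu; apply: (indec_not_uniform iX c3 uX) => v w.
rewrite !inE => /andP[vu vX] /andP[wu wX].
have ne y := @mem_neq X y x xX.
by rewrite e_sym tu ?ne // [RHS]e_sym tu ?ne // e_sym [RHS]e_sym; apply: ux.
Qed.

(* A witness of decomposability of [X + x + y], sorted by its trace on [X]. *)
Lemma ext2_cases x y : x \notin X -> y \notin X -> x != y ->
  ~~ indec (x |: (y |: X)) ->
  [\/ uniform X x /\ (uniform X y \/ (forall u, u \in X -> e x u = e x y)),
      uniform X y /\ (forall u, u \in X -> e y u = e y x),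
      twins X x y
    | exists2 u, u \in X &
      [\/ twins X u x /\ twins X u y,
          twins X u x /\ e y u = e y x |
          twins X u y /\ e x u = e x y]].
Proof.
move=> xX yX xy /forallPn[I]; rewrite negb_imply negb_or -ltnNge.
case/and3P=> hI /card_gt1P[s [t [sI tI st]]] nsub.
have hX : intv X I by apply: intv_sub hI; rewrite setUA subsetUr.
have XXxy v : v \in X -> v \in x |: (y |: X) by move=> vX; rewrite !inE vX !orbT.
have xXxy : x \in x |: (y |: X) by rewrite !inE eqxx.
have yXxy : y \in x |: (y |: X) by rewrite !inE eqxx orbT.
have ne v z := @mem_neq X v z.
move/intvP: hI => hI.
have /forallP/(_ I) := iX; rewrite hX /= => /orP[c1|/subsetP XI]; last first.
  have [xI|xI] := boolP (x \in I); have [yI|yI] := boolP (y \in I).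
  - case/negP: nsub; rewrite !subUset !sub1set xI yI /=; exact/subsetP.
  - apply: Or42; split => [u v uX vX|u uX]; apply: hI; auto.
  - apply: Or41; split => [u v uX vX|]; last right => u uX; apply: hI; auto.
  - apply: Or41; split; last left; move=> u v uX vX; apply: hI; auto.
have tw u z : u \in X -> u \in I -> z \in I -> z \in x |: (y |: X) -> twins X u z.
  move=> uX uI zI zXxy v vX vu vz; apply: hI; auto.
  by apply/negP=> vI; case/eqP: vu; move/card_le1_eqP: c1; apply; rewrite inE ?vX ?uX.
have [XI0|[u]] := set_0Vmem (X :&: I).
  have [xI yI] : x \in I /\ y \in I.
    have aux r : r \in (x |: (y |: X)) :&: I -> (r = x) \/ (r = y).
      rewrite !inE => /andP[/or3P[/eqP|/eqP|rX] rI]; auto.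
      by move/setP/(_ r): XI0; rewrite !inE rX rI.
    move: (sI) (tI); rewrite !in_setI => /andP[_ sI'] /andP[_ tI'].
    by case: (aux _ sI) (aux _ tI) st sI' tI' => -> [] ->; rewrite ?eqxx.
  apply: Or43 => v vX vx vy; apply: hI; auto.
  by apply/negP=> vI; move/setP/(_ v): XI0; rewrite !inE vX vI.
rewrite inE => /andP[uX uI]; apply: Or44; exists u => //.
have [xI|xI] := boolP (x \in I); have [yI|yI] := boolP (y \in I).
- by apply: Or31; split; apply: tw.
- by apply: Or32; split; [apply: tw | apply: hI; auto].
- by apply: Or33; split; [apply: tw | apply: hI; auto].
- case/eqP: st; move/card_le1_eqP: c1; apply.
    move: tI; rewrite !inE => /andP[/or3P[/eqP tx|/eqP ty|->] tI //].
      by rewrite -tx tI in xI.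
    by rewrite -ty tI in yI.
  move: sI; rewrite !inE => /andP[/or3P[/eqP sx|/eqP sy|->] sI //].
    by rewrite -sx sI in xI.
  by rewrite -sy sI in yI.
Qed.

Lemma twins_uniform x y : y \notin X -> x \notin X -> twins X x y -> uniform X x -> uniform X y.
Proof.
move=> yX xX txy ux u v uX vX.
have ne w z := @mem_neq X w z.
by rewrite e_sym -txy ?ne // [RHS]e_sym -txy ?ne // e_sym [RHS]e_sym; apply: ux.
Qed.

Lemma twins_trans u x y : x \notin X -> twins X u x -> twins X x y -> twins X u y.
Proof.
move=> xX tu txy w wX wu wy.
have wx : w != x by apply: contraNneq xX => <-.
by rewrite tu // txy.
Qed.

(** Every case of [ext2_cases] compatible with the hypotheses gives a vertex of [X] that [x] sees as
    it sees [y]; uniformity spreads this over [X]. *)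
Lemma ext2_uniform x y : x \notin X -> y \notin X -> x != y ->
  ~~ indec (x |: (y |: X)) -> uniform X x -> ~ uniform X y -> uniform (y |: X) x.
Proof.
move=> xX yX xy nxy ux nuy.
suff [u uX hu] : exists2 u, u \in X & e x u = e x y.
  have hy v : v \in X -> e x v = e x y by move=> vX; rewrite -hu; apply: ux.
  move=> v w; rewrite !inE => /orP[/eqP->|vX] /orP[/eqP->|wX] //.
  - by rewrite hy.
  - by rewrite hy.
  - exact: ux.
case: (ext2_cases xX yX xy nxy) => [[_ []//]|[]//||].
- have [w wX _] := card3_third x x c3; move=> h; exists w => //; exact: h.
- by move=> txy; case: nuy; apply: twins_uniform txy ux.
- by case=> u uX [[/(uniform_not_twins uX xX ux)//]|[/(uniform_not_twins uX xX ux)//]|[_ h]]; exists u.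
Qed.

Lemma ext2_twins u x y : x \notin X -> y \notin X -> x != y -> u \in X ->
  ~~ indec (x |: (y |: X)) -> twins X u x -> ~ twins X u y -> e y u = e y x.
Proof.
move=> xX yX xy uX nxy tux ntuy.
have ne w z := @mem_neq X w z.
case: (ext2_cases xX yX xy nxy) => [[ux _]|[_ h]||].
- by case: (uniform_not_twins uX xX ux).
- exact: h.
- by move=> txy; case: ntuy; apply: twins_trans tux txy.
- case=> v vX [[tvx tvy]|[tvx h]|[tvy h]].
  + by case: ntuy; rewrite (twins_uniq uX vX xX tux tvx).
  + by rewrite (twins_uniq uX vX xX tux tvx).
  (* Here [y] is a twin of some [v] other than [u]. Then [e y u = e v u = e v x = e x y], by the
     twins [v] and [y], the twins [u] and [x], and [h]. *)
  + have uv : u != v by apply/eqP=> uv; rewrite uv in ntuy.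
    have vu : v != u by rewrite eq_sym.
    have -> : e y u = e u v by rewrite [LHS]e_sym (tvy u uX uv (ne _ _ yX uX)).
    by rewrite e_sym (tux v vX vu (ne _ _ xX vX)) e_sym h e_sym.
Qed.

(** All other kinds of intervals make [x] or [y] uniform or a twin of a vertex of [X], against the
    indecomposable extensions. *)
Lemma ext2_indec x y : x \notin X -> y \notin X -> x != y ->
  ~~ indec (x |: (y |: X)) -> indec (x |: X) -> indec (y |: X) -> twins X x y.
Proof.
move=> xX yX xy nxy ix iy.
case: (ext2_cases xX yX xy nxy) => [[ux _]|[uy _]|//|[u uX]].
- by case: (ext_not_uniform c3 xX ix).
- by case: (ext_not_uniform c3 yX iy).
by case=> [[tx _]|[tx _]|[ty _]];
  [case: (ext_not_twins c3 uX xX ix)|case: (ext_not_twins c3 uX xX ix)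
  |case: (ext_not_twins c3 uX yX iy)].
Qed.

End Extensions.


(** * The outside graph of [X]: vertices outside [X], adjacency [edge_ext X] *)

Definition edge_ext X x y :=
  [&& x \notin X, y \notin X, x != y & indec (x |: (y |: X))].

Lemma edge_ext_sym X : symmetric (edge_ext X).
Proof. by move=> x y; rewrite /edge_ext eq_sym setUCA andbCA. Qed.

Lemma edge_ext_irr X x : edge_ext X x x = false.
Proof. by rewrite /edge_ext eqxx !andbF. Qed.

Lemma edge_ext_indecF X x y : x \notin X -> y \notin X -> x != y ->
  ~~ edge_ext X x y -> ~~ indec (x |: (y |: X)).
Proof. by rewrite /edge_ext => -> -> ->. Qed.

(** Adjacent outside vertices lie in different classes: for two uniform ones [X] would be an
    interval, and in the next lemma, for two twins of [u], the set [{u, x, y}] would be one. *)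
Lemma edge_ext_uniform X x y : 2 < #|X| -> edge_ext X x y -> uniform X x ->
  ~ uniform X y.
Proof.
move=> c3 /and4P[xX yX xy /indecP ixy] ux uy.
have [u [v [uX vX uv]]] : exists u v, [/\ u \in X, v \in X & u != v].
  by apply/card_gt1P; lia.
have /subsetP/(_ x (setU11 _ _)) : x |: (y |: X) \subset X; last by rewrite (negPf xX).
apply: (ixy _ u v); rewrite ?inE ?uX ?vX ?orbT //.
apply/intvP => s r t; rewrite !inE => /or3P[/eqP->|/eqP->|->] // _ _ rX _ tX.
  exact: ux.
exact: uy.
Qed.

Lemma edge_ext_twins X u x y : 2 < #|X| -> u \in X -> edge_ext X x y ->
  twins X u x -> ~ twins X u y.
Proof.
move=> c3 uX /and4P[xX yX xy /indecP ixy] tx ty.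
have [w wX /andP[wu _]] := card3_third u u c3.
have /subsetP/(_ w) : x |: (y |: X) \subset [set u; x; y].
  apply: (ixy _ x y); rewrite ?inE ?eqxx ?orbT //.
  apply/intvP => s r t; rewrite !inE !negb_or => sX /andP[/andP[su sx] sy].
  have {}sX : s \in X by move: sX; rewrite (negPf sx) (negPf sy).
  have h p : [|| p == u, p == x | p == y] -> e s p = e s u.
    by case/or3P=> /eqP-> //; [rewrite (tx s) | rewrite (ty s)].
  by rewrite -!orbA => _ hr _ ht; rewrite h // [RHS]h.
by rewrite !inE wX !orbT (negPf wu) (negPf (mem_neq xX wX)) (negPf (mem_neq yX wX)) => /(_ isT).
Qed.

End InducedIntervals.

(** * Transport of indecomposability along isomorphisms and complements *)

Lemma indec_image (V V' : finType) (e : rel V) (e' : rel V') (c : bool)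
    (f : V -> V') (X : {set V}) :
  {in X &, injective f} ->
  {in X &, forall x y, x != y -> e' (f x) (f y) = c (+) e x y} ->
  indec e X -> indec e' (f @: X).
Proof.
move=> f_inj fe /indecP iX; apply/indecP => I ? ? /intvP hI /imsetP[y yX ->] yI.
case/imsetP=> [z zX ->] zI yz; apply/subsetP => _ /imsetP[x xX ->].
suff /subsetP/(_ x xX) : X \subset f @^-1: I by rewrite inE.
apply: (iX _ y z); rewrite ?inE //; last by apply: contraNneq yz => ->.
apply/intvP => s r t sX sI rX rI tX tI; rewrite !inE in sI rI tI.
have ne p : f p \in I -> s != p by move=> pI; apply: contraNneq sI => ->.
(* [c] tells whether [f] complements adjacency; either way equal adjacencies correspond to equal
   ones, so intervals pull back. *)
apply: (@addbI c); rewrite -!fe ?ne //.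
by apply: hI; rewrite ?imset_f.
Qed.

Lemma indec_swap (V : finType) (e : rel V) (X : {set V}) y z :
  symmetric e -> y \notin X -> z \notin X ->
  twins e X y z -> indec e (y |: X) -> indec e (z |: X).
Proof.
move=> e_sym yX zX tyz; pose f v := if v == y then z else v.
have fX v : v \in X -> f v = v by move=> vX; rewrite /f (negPf (mem_neq yX vX)).
have fy : f y = z by rewrite /f eqxx.
have -> : z |: X = f @: (y |: X).
  rewrite imsetU1 fy; congr (_ |: _).
  by rewrite -[LHS]imset_id; apply: eq_in_imset => v /fX.
apply: (@indec_image _ _ _ _ false).
  move=> v w; rewrite !inE => /orP[/eqP->|vX] /orP[/eqP->|wX] //; rewrite ?fy ?fX //.
    by move=> zw; rewrite zw wX in zX.
  by move=> zw; rewrite -zw vX in zX.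
move=> v w; rewrite !inE => /orP[/eqP->|vX] /orP[/eqP->|wX]; rewrite ?eqxx ?fy ?fX //=.
  by rewrite e_sym [RHS]e_sym (tyz w wX (mem_neq yX wX) (mem_neq zX wX)).
by rewrite (tyz v vX (mem_neq yX vX) (mem_neq zX vX)).
Qed.

(** * The Ehrenfeucht-Rozenberg extension theorem *)

Section IndecomposableSupersets.
Variables (V : finType) (e : rel V).
Hypothesis e_sym : symmetric e.
Implicit Types (X Y S I M : {set V}) (u v x y z : V).

Let edge_sym X : symmetric (edge_ext e X) := @edge_ext_sym V e X.

Lemma indecT_full M y z : indec e [set: V] -> intv e [set: V] M ->
  y \in M -> z \in M -> y != z -> forall v, v \in M.
Proof.
move=> /indecP iV hM yM zM yz v.
by apply: (subsetP (iV M y z hM _ yM _ zM yz)); rewrite inE.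
Qed.

(* In the outside graph of [X], two vertices of the same class of [X] that are
   separated by a neighbour are related as if one of them were in [X]. *)
Lemma edge_ext_separated X p q x : indec e X -> 2 < #|X| ->
  (forall v, v \notin x |: (p |: X) -> ~~ indec e (v |: (x |: (p |: X)))) ->
  edge_ext e X x p -> ~~ edge_ext e X x q -> q \notin X -> q != p ->
  (uniform e X q -> uniform e X p -> uniform e (p |: X) q) /\
  (forall u, u \in X -> twins e X u q -> twins e X u p -> e p u = e p q).
Proof.
move=> iX c3 noext xp nxq qX qp.
have [xX pX xnp ixp] := and4P xp.
case: (eqVneq q x) => [->|qx].
  split=> [ux|u uX tx] h; first by case: (edge_ext_uniform c3 xp ux h).
  by case: (edge_ext_twins c3 uX xp tx h).
have q1 : q \notin x |: (p |: X) by rewrite !inE !negb_or qx qp.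
have pX1 : p |: X \subset x |: (p |: X) by rewrite subsetUr.
have xX1 : x |: X \subset x |: (p |: X) by rewrite setUCA subsetUr.
have XX1 : X \subset x |: (p |: X) by rewrite setUA subsetUr.
have c1 : 2 < #|x |: (p |: X)| by rewrite (leq_trans c3) ?subset_leq_card.
(* If [p] and [q] were twins here, exchanging them would make [q] a neighbour of [x] too. *)
have swap : ~ twins e (x |: (p |: X)) p q.
  move=> tpq; case/negP: nxq; rewrite /edge_ext xX qX eq_sym qx setUCA.
  apply: (@indec_swap V e (x |: X) p q); rewrite // ?inE ?negb_or ?(negPf qx) //.
  - by rewrite eq_sym xnp.
  - exact: twins_sub tpq.
  - by rewrite setUCA.
have twx u : u \in X -> twins e X u q -> twins e X u p -> ~ twins e (x |: (p |: X)) x q.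
  move=> uX tq tp txq; apply: (edge_ext_twins c3 uX xp) tp.
  apply: (twins_trans (x := q)) => //.
  exact: twinsC (twins_sub XX1 txq).
have unx : uniform e X q -> uniform e X p -> ~ twins e (x |: (p |: X)) x q.
  move=> uq up txq; apply: (edge_ext_uniform c3 xp) up.
  by apply: (twins_uniform e_sym) uq => //; apply: twinsC (twins_sub XX1 txq).
case: (ext_class ixp q1 (noext q q1)) => [uq1|[w]].
  split=> [_ _|u uX tq]; first exact: uniform_sub uq1.
  by case: (uniform_not_twins e_sym iX c3 uX qX (uniform_sub XX1 uq1) tq).
rewrite !inE => /or3P[/eqP->|/eqP->|wX] tw.
- split=> [uq up|u uX tq tp]; first by case: (unx uq up tw).
  by case: (twx u uX tq tp tw).
- by case: (swap tw).
split=> [uq up|u uX tq tp].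
  by case: (uniform_not_twins e_sym iX c3 wX qX uq (twins_sub XX1 tw)).
rewrite (twins_uniq iX c3 uX wX qX tq (twins_sub XX1 tw)).
apply: tw; rewrite ?inE ?eqxx ?orbT //; last by rewrite eq_sym.
by rewrite eq_sym (mem_neq pX wX).
Qed.

(** An isolated [x] would produce a nontrivial interval of the whole graph: the complement of the
    set of isolated uniform vertices if [x] is uniform, and [u] with its isolated twins if [x] is a
    twin of [u]. *)
Lemma edge_ext_no_isolated X x : indec e [set: V] -> indec e X -> 2 < #|X| ->
  (forall y z v, edge_ext e X y z -> v \notin y |: (z |: X) ->
     ~~ indec e (v |: (y |: (z |: X)))) ->
  x \notin X -> ~~ indec e (x |: X) -> exists y, edge_ext e X x y.
Proof.
move=> iV iX c3 noext xX nix; apply/existsP; apply: contraT; rewrite negb_exists => /forallP isox.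
pose iso := [pred z | (z \notin X) && [forall y, ~~ edge_ext e X z y]].
have isoE z y : iso z -> ~~ edge_ext e X z y by move=> /andP[_ /forallP].
have isoX : iso x by rewrite /= xX; apply/forallP.
have noniso z : z \notin X -> ~~ iso z -> exists y, edge_ext e X y z.
  move=> zX; rewrite /= zX /= negb_forall => /existsP[y /negPn zy].
  by exists y; rewrite edge_sym.
have [w [w' [wX w'X ww']]] : exists u v, [/\ u \in X, v \in X & u != v].
  by apply/card_gt1P; lia.
case: (ext_class iX xX nix) => [ux|[u uX tux]].
  pose M := [set z | ~~ (iso z && [forall u in X, forall v in X, e z u == e z v])].
  have XM v : v \in X -> v \in M by move=> vX; rewrite !inE vX.
  suff hM : forall v, v \in M.
    by have := hM x; rewrite inE isoX (introT (uniformP _ _ _) ux).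
  apply: (indecT_full iV _ (XM _ wX) (XM _ w'X) ww').
  apply/intvP => v s t _; rewrite inE negbK => /andP[iv /uniformP uv] _ sM _ tM.
  have vX : v \notin X by case/andP: iv.
  suff h r : r \in M -> e v r = e v w by rewrite h // [RHS]h.
  have [rX _|rX] := boolP (r \in X); first exact: uv.
  rewrite inE negb_and => hr.
  have rv : r != v.
    by apply: contraTneq hr => ->; rewrite -negb_and negbK iv; apply/uniformP.
  have [/uniformP ur|/uniformP nur] := boolP [forall u in X, forall v in X, e r u == e r v].
    (* Now [r] is uniform like [v], but has a neighbour [z], which the isolated [v] has not; so [z]
       separates them. *)
    have nr : ~~ iso r by case/orP: hr => //; rewrite (introT (uniformP _ _ _) ur).
    have [z zr] := noniso r rX nr.
    have [h _] := edge_ext_separated (q := v) iX c3 (fun v => noext z r v zr) zr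
       ltac:(rewrite edge_sym; exact: isoE) vX ltac:(by rewrite eq_sym).
    by apply: h; rewrite ?inE ?eqxx ?wX ?orbT.
  have := ext2_uniform e_sym iX c3 vX rX ltac:(by rewrite eq_sym)
    (edge_ext_indecF vX rX ltac:(by rewrite eq_sym) (isoE _ _ iv)) uv nur.
  by apply; rewrite ?inE ?eqxx ?wX ?orbT.
pose M := [set z | (z == u) || (iso z &&
  [forall v in X, (v != u) ==> (v != z) ==> (e v u == e v z)])].
have uM : u \in M by rewrite inE eqxx.
have xM : x \in M by rewrite inE isoX (introT (twinsP _ _ _ _) tux) orbT.
have [y yX /andP[yu _]] := card3_third u u c3.
suff /(_ y) : forall v, v \in M by rewrite !inE yX (negPf yu).
apply: (indecT_full iV _ uM xM (mem_neq xX uX)).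
apply/intvP => v s t _ vM _ sM _ tM.
suff h r : r \in M -> e v r = e v u by rewrite h // [RHS]h.
rewrite inE => /orP[/eqP->//|/andP[ir /twinsP tr]].
move: vM; rewrite inE negb_or => /andP[vu nv].
have rX : r \notin X by case/andP: ir.
have [vX|vX] := boolP (v \in X).
  by rewrite tr // (mem_neq rX vX).
have rv : r != v.
  by apply: contraNneq nv => <-; rewrite ir; apply/twinsP.
have [/twinsP tv|/twinsP ntv] := boolP [forall w in X, (w != u) ==> (w != v) ==> (e w u == e w v)].
  have niv : ~~ iso v by apply: contra nv => ->; apply/twinsP.
  have [z zv] := noniso v vX niv.
  have [_ h] := edge_ext_separated (q := r) iX c3 (fun w => noext z v w zv) zv
       ltac:(rewrite edge_sym; exact: isoE) rX rv.
  by rewrite h.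
by rewrite (ext2_twins e_sym iX c3 rX vX rv uX (edge_ext_indecF rX vX rv (isoE _ _ ir)) tr ntv).
Qed.

(** Without an edge in the outside graph, every outside vertex extends [X] to an indecomposable set,
    by the previous lemma with its third premise vacuous. Any two outside vertices are then twins
    over [X], so [~: X] is a nontrivial interval. *)
Lemma ehrenfeucht_rozenberg X : indec e [set: V] -> indec e X -> 2 < #|X| ->
  1 < #|~: X| -> exists x y, edge_ext e X x y.
Proof.
move=> iV iX c3 c2.
have [/existsP[x /existsP[y xy]]|] := boolP [exists x, exists y, edge_ext e X x y].
  by exists x, y.
rewrite negb_exists => /forallP no.
have noE x y : ~~ edge_ext e X x y by have := no x; rewrite negb_exists => /forallP.
have ext x : x \notin X -> indec e (x |: X).
  move=> xX; apply: contraT => nix.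
  have [|y xy] := edge_ext_no_isolated iV iX c3 _ xX nix; last by rewrite (negPf (noE x y)) in xy.
  by move=> y z v yz; rewrite (negPf (noE y z)) in yz.
pose M := ~: X.
have [x [y [xM yM xy]]] : exists x y, [/\ x \in M, y \in M & x != y] by apply/card_gt1P.
have [w wX _] := card3_third x x c3.
suff /(_ w) : forall v, v \in M by rewrite inE wX.
apply: (indecT_full iV _ xM yM xy).
apply/intvP => v s t _; rewrite !inE negbK => vX _ sX _ tX.
have [->//|st] := eqVneq s t.
have tst := ext2_indec iX c3 sX tX st (edge_ext_indecF sX tX st (noE _ _)) (ext s sX) (ext t tX).
by rewrite tst // ?(mem_neq sX vX) ?(mem_neq tX vX).
Qed.

(** * Structure of the outside graph *)

Section OutsideGraph.
Variable X : {set V}.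
Hypotheses (iX : indec e X) (c3 : 2 < #|X|).
Local Notation out := (edge_ext e X).

(** An interval with two vertices in the union of [X] and an edge of [S] contains that union, hence
    everything, because no vertex of [S] is isolated. The remaining intervals lie in [S]; a vertex
    of [S] adjacent to just one of two members either belongs to the interval, giving such an edge,
    or contradicts [indec_swap]. *)
Lemma edge_ext_core S : [disjoint S & X] ->
  (forall x, x \in S -> exists2 y, y \in S & out x y) ->
  (forall y z, y \in S -> z \in S -> y != z ->
     exists2 x, x \in S & out x y != out x z) ->
  indec e (X :|: S).
Proof.
move=> dSX iso twf; apply/indecP => I y z hI yXS yI zXS zI yz.
have SX s : s \in S -> s \notin X by move=> /(disjointFr dSX)->.
have sub s t : s \in S -> t \in S -> s |: (t |: X) \subset X :|: S.
  by move=> sS tS; rewrite !subUset !sub1set !inE sS tS !orbT subsetUl.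
have edge s t p q : s \in S -> t \in S -> out s t ->
    p \in s |: (t |: X) -> p \in I -> q \in s |: (t |: X) -> q \in I -> p != q ->
    s |: (t |: X) \subset I.
  move=> sS tS /and4P[_ _ _ /indecP ist]; apply: ist.
  exact: intv_sub (sub _ _ sS tS) hI.
have [u [v [uX vX uv]]] : exists u v, [/\ u \in X, v \in X & u != v].
  by apply/card_gt1P; lia.
have full : X \subset I -> X :|: S \subset I.
  move=> /subsetP XI; apply/subsetP => s; rewrite inE => /orP[/XI//|sS].
  have [t tS st] := iso s sS.
  by apply: (subsetP (edge s t u v sS tS st _ (XI _ uX) _ (XI _ vX) uv)); rewrite ?inE ?uX ?vX ?eqxx ?orbT.
have full2 s t : s \in S -> t \in S -> out s t -> s |: (t |: X) \subset I -> X :|: S \subset I.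
  by move=> sS tS st h; apply: full; apply: subset_trans h; rewrite setUA subsetUr.
have [XI0|[w]] := set_0Vmem (X :&: I); last first.
  rewrite inE => /andP[wX wI].
  have [r [rXS rI rw]] : exists r, [/\ r \in X :|: S, r \in I & r != w].
    by case: (eqVneq y w) => [yw|]; [exists z | exists y]; rewrite // -yw eq_sym.
  move: rXS; rewrite inE => /orP[rX|rS].
    apply: full; move/indecP: iX; apply; [|exact: rX|exact: rI|exact: wX|exact: wI|exact: rw].
    exact: intv_sub (subsetUl _ _) hI.
  have [t tS rt] := iso r rS; apply: (full2 r t) => //.
  by apply: (edge r t r w) => //; rewrite !inE ?eqxx ?wX ?orbT.
have nXI x : x \in X -> x \notin I.
  by move=> xX; apply/negP=> xI; move/setP/(_ x): XI0; rewrite !inE xX xI.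
have inS x : x \in X :|: S -> x \in I -> x \in S.
  by rewrite inE => /orP[/nXI/negPf->|].
have {yXS}yS := inS y yXS yI; have {zXS}zS := inS z zXS zI.
have aux p q x : p \in S -> q \in S -> p \in I -> q \in I -> p != q -> x \in S ->
    out x p -> ~~ out x q -> X :|: S \subset I.
  move=> pS qS pI qI pq xS xp nxq.
  have [xI|xI] := boolP (x \in I).
    apply: (full2 x p) => //.
    have [_ _ xnp _] := and4P xp.
    by apply: (edge x p x p) => //; rewrite !inE ?eqxx ?orbT.
  case/negP: nxq; have [xX pX xnp ixp] := and4P xp.
  have xq : x != q by apply: contraNneq xI => ->.
  rewrite /edge_ext xX SX // xq setUCA.
  apply: (@indec_swap V e (x |: X) p q); rewrite // ?inE ?negb_or.
  - by rewrite eq_sym xnp.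
  - by rewrite eq_sym xq SX.
  - move/intvP: hI => hI v'; rewrite inE => /orP[/set1P->|v'X] _ _; apply: hI; rewrite ?inE ?xS ?pS ?qS ?v'X ?orbT //.
    exact: nXI.
  - by rewrite setUCA.
have [x xS] := twf y z yS zS yz.
case E1: (out x y); case E2: (out x z) => // _.
  by apply: (aux y z x) => //; rewrite E2.
by apply: (aux z y x) => //; rewrite ?E1 // eq_sym.
Qed.

Hypothesis iV : indec e [set: V].
Hypothesis no_ext : forall x, x \notin X -> ~~ indec e (x |: X).
Hypothesis no_ext2 : forall y z v, out y z -> v \notin y |: (z |: X) ->
  ~~ indec e (v |: (y |: (z |: X))).

(** Classify [z] over the indecomposable set [y |: (x |: X)]: as [z |: (x |: X)] is indecomposable,
    [z] can only be a twin of [y]. *)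
Lemma edge_ext_nbr_twins x y z : out x y -> out x z -> y != z -> twins e (x |: X) y z.
Proof.
rewrite edge_sym => yx xz yz.
have [yX xX nyx iyx] := and4P yx; have [_ zX nxz ixz] := and4P xz.
have z1 : z \notin y |: (x |: X) by rewrite !inE !negb_or eq_sym yz eq_sym nxz.
have cx : 2 < #|x |: X| by rewrite (leq_trans c3) // subset_leq_card // subsetUr.
have zxX : z \notin x |: X by rewrite !inE negb_or eq_sym nxz.
have sub : x |: X \subset y |: (x |: X) by rewrite subsetUr.
have izx : indec e (z |: (x |: X)) by rewrite setUCA.
case: (ext_class iyx z1 (no_ext2 yx z1)) => [uz|[w]].
  by case: (ext_not_uniform cx zxX izx); apply: uniform_sub uz.
rewrite inE => /orP[/set1P->|wX] tw; first exact: twins_sub tw.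
by case: (ext_not_twins cx wX zxX izx); apply: twins_sub tw.
Qed.

(** Neighbours of [x] are twins over [X], hence of the same class, whereas edges join different
    classes. *)
Lemma edge_ext_nbr_nonadj x y z : out x y -> out x z -> ~~ out y z.
Proof.
move=> xy xz; case: (eqVneq y z) => [->|yz]; first by rewrite edge_ext_irr.
have [xX yX _ _] := and4P xy; have [_ zX _ _] := and4P xz.
have tyz : twins e X y z := twins_sub (subsetUr _ _) (edge_ext_nbr_twins xy xz yz).
apply/negP=> oyz.
case: (ext_class iX yX (no_ext yX)) => [uy|[u uX ty]].
  by apply: (edge_ext_uniform c3 oyz uy); apply: (twins_uniform e_sym _ _ tyz uy).
by apply: (edge_ext_twins c3 uX oyz ty); apply: (twins_trans yX ty tyz).
Qed.

(** Otherwise the outside vertices with the same neighbourhood as [y] form a nontrivial interval of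
    the whole graph. *)
Lemma edge_ext_twin_free y z : y \notin X -> z \notin X -> y != z ->
  exists x, out x y != out x z.
Proof.
move=> yX zX yz; apply/existsP; apply: contraT; rewrite negb_exists => /forallP twn.
pose M := [set t | (t \notin X) && [forall x, out x t == out x y]].
have [w wX _] := card3_third y y c3.
suff hM : forall v, v \in M by have := hM w; rewrite inE wX.
have yM : y \in M by rewrite inE yX; apply/forallP.
have zM : z \in M.
  by rewrite inE zX; apply/forallP => x; have := twn x; rewrite negbK eq_sym.
apply: (indecT_full iV _ yM zM yz).
apply/intvP => v s t _ vM _ sM _ tM.
have [->//|st] := eqVneq s t.
have [sX tX] : s \notin X /\ t \notin X.
  by move: sM tM; rewrite !inE => /andP[-> _] /andP[-> _].
have sy x : out x s = out x y by move: sM; rewrite inE => /andP[_ /forallP/(_ x)/eqP].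
have st_out x : out x t = out x s.
  by rewrite sy; move: tM; rewrite inE => /andP[_ /forallP/(_ x)/eqP].
have [vs vt] : v != s /\ v != t by split; apply: contraNneq vM => ->.
have [x] := edge_ext_no_isolated iV iX c3 no_ext2 sX (no_ext sX).
rewrite edge_sym => xs.
have xt : out x t by rewrite st_out.
have [xX _ _ _] := and4P xs.
have tst := edge_ext_nbr_twins xs xt st.
have tstX : twins e X s t := twins_sub (subsetUr _ _) tst.
have [vX|vX] := boolP (v \in X); first exact: tstX.
have [ovs|nvs] := boolP (out v s).
  have ovt : out v t by rewrite st_out.
  by apply: (edge_ext_nbr_twins ovs ovt st); rewrite ?setU11.
have nvt : ~~ out v t by rewrite st_out.
have nsv : ~~ out s v by rewrite edge_sym.
have ntv : ~~ out t v by rewrite edge_sym.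
(* What remains is a vertex [v] adjacent to neither [s] nor [t], and [x'] is adjacent to exactly one
   of [v] and [s]. If [v] has the class of [s], [edge_ext_separated] applies; if not, [ext2_uniform]
   or [ext2_twins] does. *)
have /existsP[x' hx'] : [exists x, out x v != out x s].
  rewrite -negb_forall; apply: contra vM => /forallP h; rewrite inE vX.
  by apply/forallP => x''; rewrite -sy.
have sv : s != v by rewrite eq_sym.
have tv : t != v by rewrite eq_sym.
have sep p q r : out r p -> ~~ out r q -> q \notin X -> q != p -> _ :=
  fun rp => edge_ext_separated iX c3 (fun v => no_ext2 rp) rp.
case: (ext_class iX sX (no_ext sX)) => [us|[u uX ts]].
  have ut : uniform e X t by apply: (twins_uniform e_sym _ _ tstX us).
  have sw : e w s = e w t by rewrite tstX ?(mem_neq _ wX).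
  suff h : (forall r, r \in [:: s; t] -> e r v = e r w) \/ e v s = e v t.
    case: h => [h|//]; rewrite e_sym [RHS]e_sym !h ?inE ?eqxx ?orbT //.
    by rewrite e_sym [RHS]e_sym.
  have [/uniformP uv|/uniformP nuv] :=
    boolP [forall p in X, forall q in X, e v p == e v q]; last first.
    have h r : r \notin X -> r != v -> ~~ out r v -> uniform e X r -> e r v = e r w.
      move=> rX rv nrv ur.
      have := ext2_uniform e_sym iX c3 rX vX rv (edge_ext_indecF rX vX rv nrv) ur nuv.
      by apply; rewrite ?inE ?eqxx ?wX ?orbT.
    by left=> r; rewrite !inE => /orP[]/eqP->; apply: h.
  case E: (out x' s) hx' => hx'.
    have nx'v : ~~ out x' v by move: hx'; case: (out x' v).
    right; have h r : out x' r -> r != v -> uniform e X r -> e v r = e v w.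
      move=> x'r rv ur; have [||h _] := sep r v x' x'r nx'v; rewrite 1?eq_sym //.
      by apply: h; rewrite ?inE ?eqxx ?wX ?orbT.
    by rewrite !h // st_out.
  have x'v : out x' v by move: hx'; case: (out x' v).
  left=> r rst; have [rX [rv [nx'r ur]]] :
      r \notin X /\ r != v /\ ~~ out x' r /\ uniform e X r.
    by move: rst; rewrite !inE => /orP[]/eqP->; rewrite ?st_out E.
  have [//|//|h _] := sep v r x' x'v nx'r.
  by apply: h; rewrite ?inE ?eqxx ?wX ?orbT.
have tt : twins e X u t := twins_trans sX ts tstX.
have su : e u s = e u t by rewrite tstX ?(mem_neq sX uX) ?(mem_neq tX uX).
have [/twinsP tv'|/twinsP ntv'] :=
  boolP [forall w in X, (w != u) ==> (w != v) ==> (e w u == e w v)]; last first.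
  have h r : r \notin X -> r != v -> ~~ out r v -> twins e X u r -> e v u = e v r.
    move=> rX rv nrv tr.
    exact: (ext2_twins e_sym iX c3 rX vX rv uX (edge_ext_indecF rX vX rv nrv) tr ntv').
  by rewrite -(h s) // (h t).
case E: (out x' s) hx' => hx'.
  have nx'v : ~~ out x' v by move: hx'; case: (out x' v).
  have h r : out x' r -> r != v -> twins e X u r -> e r u = e r v.
    move=> x'r rv tr; have [||_ h] := sep r v x' x'r nx'v; rewrite 1?eq_sym //.
    exact: h tv' tr.
  by rewrite e_sym [RHS]e_sym -(h s) // -(h t) ?st_out // e_sym [RHS]e_sym.
have x'v : out x' v by move: hx'; case: (out x' v).
have h r : r \notin X -> r != v -> ~~ out x' r -> twins e X u r -> e v u = e v r.
  move=> rX rv nx'r tr; have [||_ h] := sep v r x' x'v nx'r; rewrite //.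
  exact: h tr tv'.
by rewrite -(h s) // ?E // (h t) // st_out E.
Qed.

(* Two nonnested neighbourhoods would give a five-vertex path or cycle in the
   outside graph, hence five vertices that can be added to [X]. *)
Lemma edge_ext_nested x y z :
  (forall S, [disjoint S & X] -> #|S| = 5 -> ~~ indec e (X :|: S)) ->
  out x y -> out x z ->
  (forall t, out y t -> out z t) \/ (forall t, out z t -> out y t).
Proof.
move=> no5 xy xz.
have [/forallP h|] := boolP [forall t, out y t ==> out z t].
  by left=> t; apply: implyP.
rewrite negb_forall => /existsP[y']; rewrite negb_imply => /andP[yy' nzy'].
have [/forallP h|] := boolP [forall t, out z t ==> out y t].
  by right=> t; apply: implyP.
rewrite negb_forall => /existsP[z']; rewrite negb_imply => /andP[zz' nyz'].
exfalso.
have yx : out y x by rewrite edge_sym.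
have zx : out z x by rewrite edge_sym.
have y'y : out y' y by rewrite edge_sym.
have z'z : out z' z by rewrite edge_sym.
have yz : out y z = false := negbTE (edge_ext_nbr_nonadj xy xz).
have zy : out z y = false by rewrite edge_sym.
have xy' : out x y' = false := negbTE (edge_ext_nbr_nonadj yx yy').
have y'x : out y' x = false by rewrite edge_sym.
have xz' : out x z' = false := negbTE (edge_ext_nbr_nonadj zx zz').
have z'x : out z' x = false by rewrite edge_sym.
have yz' : out y z' = false := negbTE nyz'.
have z'y : out z' y = false by rewrite edge_sym.
have zy' : out z y' = false := negbTE nzy'.
have y'z : out y' z = false by rewrite edge_sym.
have irr t : out t t = false := edge_ext_irr e X t.
(* The pair [y'], [z'] is left open: the five vertices form a cycle if it is an edge, a path
   otherwise. The known adjacencies already separate any two of the vertices. *)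
have adjs := (yx, zx, y'y, z'z, xy, xz, yy', zz', yz, zy, xy', y'x, xz', z'x, yz', z'y, zy', y'z, irr).
have neq p q r : out r p != out r q -> p != q by apply: contraNneq => ->.
have un : uniq [:: y'; y; x; z; z'].
  rewrite /= !inE !negb_or.
  rewrite (neq y' y y) ?(neq y' x z) ?(neq y' z y) ?(neq y' z' y) ?adjs //.
  rewrite (neq y x x) ?(neq y z y') ?(neq y z' x) ?adjs //.
  by rewrite (neq x z z) ?(neq x z' y) ?(neq z z' x) ?adjs.
have mem t : t \in [:: y'; y; x; z; z'] -> t \notin X.
  have outX p q : out p q -> p \notin X by case/and4P.
  rewrite !inE => /or4P[||| /orP[]] /eqP->; [exact: outX y'y|exact: outX yx|exact: outX xy|exact: outX zx|exact: outX z'z].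
pose S := [set t in [:: y'; y; x; z; z']].
have dS : [disjoint S & X].
  by rewrite disjoint_subset; apply/subsetP => t; rewrite inE => /mem; rewrite inE.
have cS : #|S| = 5 by rewrite cardsE; rewrite (card_uniqP un).
case/negP: (no5 S dS cS); apply: edge_ext_core => //.
  move=> t; rewrite inE !inE => /or4P[||| /orP[]] /eqP->; [exists y|exists x|exists y|exists x|exists z]; by rewrite ?inE ?eqxx ?orbT.
have inS : [/\ y' \in S, y \in S, x \in S, z \in S & z' \in S] by rewrite !inE !eqxx !orbT.
case: inS => s1 s2 s3 s4 s5.
move=> p q; rewrite inE !inE => /or4P[||| /orP[]] /eqP-> /or4P[||| /orP[]] /eqP->; rewrite ?eqxx // => _;
  first [ by exists y'; rewrite ?adjs | by exists y; rewrite ?adjs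
        | by exists x; rewrite ?adjs | by exists z; rewrite ?adjs | by exists z'; rewrite ?adjs ].
Qed.

End OutsideGraph.

(** * Parity of the outside graph and supersets of codimension two *)

Lemma involution_even (W : {set V}) (f : V -> V) :
  {in W, forall x, [/\ f x \in W, f x != x & f (f x) = x]} -> ~~ odd #|W|.
Proof.
have [n] := ubnP #|W|; elim: n W => // n IHn W ltWn fW.
have [->|[x xW]] := set_0Vmem W; first by rewrite cards0.
have [fxW fxx ffx] := fW x xW.
rewrite (cardsD1 x W) xW (cardsD1 (f x)) !inE fxx fxW /= negbK.
apply: IHn.
  by move: ltWn; rewrite (cardsD1 x W) xW (cardsD1 (f x)) !inE fxx fxW /=; lia.
move=> y; rewrite !inE => /and3P[yfx yx yW]; have [fyW fyy ffy] := fW y yW.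
split=> //; rewrite ?inE fyW andbT; apply/andP; split.
  by apply: contra_neq yx => h; rewrite -ffy h.
by apply: contra_neq yfx => h; rewrite -ffy h.
Qed.

(* Twin-freeness and nestedness make every component of the outside graph a
   half graph, in which a vertex is matched with its neighbour of smallest
   neighbourhood. *)
Lemma outside_even X : indec e [set: V] -> indec e X -> 2 < #|X| ->
  (forall x, x \notin X -> ~~ indec e (x |: X)) ->
  (forall y z v, edge_ext e X y z -> v \notin y |: (z |: X) ->
     ~~ indec e (v |: (y |: (z |: X)))) ->
  (forall S, [disjoint S & X] -> #|S| = 5 -> ~~ indec e (X :|: S)) ->
  ~~ odd #|~: X|.
Proof.
move=> iV iX c3 ext1 ext2 no5; pose out := edge_ext e X.
have outX p q : out p q -> p \notin X by case/and4P.
have nested := edge_ext_nested iX c3 ext1 ext2 no5.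
pose partner x p := out x p && [forall y, out x y ==> [forall t, out p t ==> out y t]].
have partnerP x p : reflect (out x p /\ forall y t, out x y -> out p t -> out y t) (partner x p).
  apply: (iffP andP) => -[xp h]; split => //.
    by move=> y t xy pt; move/forallP/(_ y)/implyP/(_ xy)/forallP/(_ t)/implyP: h; apply.
  by apply/forallP => y; apply/implyP => xy; apply/forallP => t; apply/implyP; apply: h.
have ex x : x \notin X -> exists p, partner x p.
  move=> xX; have [y0 xy0] := edge_ext_no_isolated iV iX c3 ext2 xX (ext1 x xX).
  case: (arg_minnP (fun y => #|[set t | out y t]|) xy0) => p xp min.
  exists p; apply/partnerP; split=> // y t xy pt.
  case: (nested x y p xy xp) => h; last exact: h.
  have : [set t | out y t] == [set t | out p t].
    rewrite eqEcard min // andbT; apply/subsetP => s; rewrite !inE; exact: h.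
  by move/eqP/setP/(_ t); rewrite !inE pt.
have uniq_partner x p q : partner x p -> partner x q -> p = q.
  move=> /partnerP[xp hp] /partnerP[xq hq]; apply/eqP; apply: contraT => pq.
  have pX : p \notin X by apply: (outX p x); rewrite /out edge_sym.
  have qX : q \notin X by apply: (outX q x); rewrite /out edge_sym.
  have [t] := edge_ext_twin_free iX c3 iV ext1 ext2 pX qX pq.
  rewrite edge_sym [X in _ != X]edge_sym; case/eqP.
  by apply/idP/idP; [apply: hp | apply: hq].
(* Being partners means that every neighbour of [x] is adjacent to every neighbour of [p], which is
   symmetric. *)
have partner_sym x p : partner x p -> partner p x.
  move=> /partnerP[xp hp]; apply/partnerP; split; first by rewrite /out edge_sym.
  by move=> y t py xt; rewrite /out edge_sym; apply: hp py.
pose f x := odflt x [pick p | partner x p].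
have fP x : x \notin X -> partner x (f x).
  by move=> /ex[p xp]; rewrite /f; case: pickP => [//|/(_ p)]; rewrite xp.
apply: (@involution_even _ f) => x; rewrite inE => xX.
have pxf := fP x xX; have [xf _] := partnerP _ _ pxf.
have fX : f x \notin X by apply: (outX _ x); rewrite /out edge_sym.
split; first by rewrite inE.
  by have [_ _] := and4P xf; rewrite eq_sym.
exact: uniq_partner (fP _ fX) (partner_sym _ _ pxf).
Qed.

Lemma indec_codim2 X : indec e [set: V] -> indec e X -> 2 < #|X| ->
  (if odd #|~: X| then 6 else 1) < #|~: X| ->
  exists Y : {set V}, [/\ X \subset Y, indec e Y & #|~: Y| = 2].
Proof.
move=> iV; have even_case Y : indec e Y -> 2 < #|Y| -> ~~ odd #|~: Y| ->
    1 < #|~: Y| -> exists Z : {set V}, [/\ Y \subset Z, indec e Z & #|~: Z| = 2].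
  have [n] := ubnP #|~: Y|; elim: n Y => // n IHn Y ltYn iY c3 ev c1.
  have [c2|c2] := eqVneq #|~: Y| 2; first by exists Y.
  have [x [y xy]] := ehrenfeucht_rozenberg iV iY c3 c1.
  have [xY yY nxy ixy] := and4P xy.
  have sub : Y \subset x |: (y |: Y) by rewrite setUA subsetUr.
  have cC : #|~: Y| = #|~: (x |: (y |: Y))| + 2.
    have := cardsC Y; have := cardsC (x |: (y |: Y)).
    by rewrite !cardsU1 !inE negb_or nxy xY yY /=; lia.
  have [|||||Z [sZ iZ cZ]] := IHn (x |: (y |: Y)); rewrite ?ixy //; try lia.
  - by rewrite (leq_trans c3) ?subset_leq_card.
  - by exists Z; split=> //; apply: subset_trans sZ.
move=> iX c3; case: ifPn => [oX c6|]; last by move=> ev; apply: even_case.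
have [/existsP[Y /and4P[XY iY ev c1]]|] :=
  boolP [exists Y : {set V}, [&& X \subset Y, indec e Y, ~~ odd #|~: Y| & 1 < #|~: Y|]].
  have [|Z [YZ iZ cZ]] := even_case Y iY _ ev c1.
    by rewrite (leq_trans c3) ?subset_leq_card.
  by exists Z; split=> //; apply: subset_trans YZ.
rewrite negb_exists => /forallP no.
(* Adding 1, 3 or 5 vertices to [X] leaves an even codimension, at least 7 - 5 = 2; hence the bound
   6 in the statement. *)
have noY (Y : {set V}) k : X \subset Y -> #|Y| = #|X| + k -> odd k -> k < 6 -> ~~ indec e Y.
  move=> XY cY ok k6; apply: contra (no Y) => ->; rewrite XY /=.
  have := cardsC X; have := cardsC Y.
  by move: oX c6; lia.
suff : ~~ odd #|~: X| by rewrite oX.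
apply: outside_even => //.
- by move=> x xX; apply: (noY _ 1); rewrite ?subsetUr // cardsU1 xX addnC.
- move=> y z v /and4P[yX zX yz _] vX; apply: (noY _ 3) => //.
    by rewrite !setUA subsetUr.
  by rewrite cardsU1 vX !cardsU1 !inE negb_or yz yX zX /=; lia.
move=> S dS cS; apply: (noY _ 5); rewrite ?subsetUl //.
by rewrite cardsU -cS; move: dS; rewrite disjoint_sym -setI_eq0 => /eqP->; rewrite cards0 subn0.
Qed.

End IndecomposableSupersets.

(** * Separating chains, and the paths and graphs [Q_m] inside them *)

Section Chains.
Variables (V : finType) (G : sgraph V).
Implicit Types (s t p : seq V) (u v w x y z a b : V).

(* Sequences are listed backwards: the head is the vertex added last. *)
Inductive induced_path a : seq V -> Prop :=
  | InducedPath1 : induced_path a [:: a]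
  | InducedPathS v w t of induced_path a (w :: t) & v \notin w :: t & G v w &
      {in t, forall z, ~~ G v z} : induced_path a [:: v, w & t].

(** The path is cut back to the neighbour of [v] closest to [a]. *)
Lemma induced_path_extend a p v : induced_path a p -> v \notin p -> has (G v) p ->
  exists2 t, induced_path a (v :: t) & {subset t <= p}.
Proof.
elim=> [|v' w t pwt IH v'w vw nt] vp.
  rewrite /= orbF => va; exists [:: a] => //.
  by apply: InducedPathS => //; apply: InducedPath1.
have [hp|nh] := boolP (has (G v) (w :: t)).
  move=> _; have [|t' pt' st'] := IH _ hp; first by move: vp; rewrite inE negb_or => /andP[].
  by exists t' => // z /st' zt; rewrite inE zt orbT.
rewrite -[has _ _]/(G v v' || has (G v) (w :: t)) (negPf nh) orbF => vv'; exists [:: v', w & t] => //.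
apply: InducedPathS => //; first exact: InducedPathS.
by apply/allP; rewrite -[all _ _]/(all (predC (G v)) (w :: t)) all_predC.
Qed.

Lemma induced_path_uniq a p : induced_path a p -> uniq p.
Proof. by elim=> // v w t _ u nv _ _; rewrite cons_uniq nv. Qed.

Lemma induced_path_last a p z : induced_path a p -> last z p = a.
Proof. by move=> h; elim: h z. Qed.

Lemma induced_path_nth a p z i j : induced_path a p -> i < j < size p ->
  G (nth z p i) (nth z p j) = (j == i.+1).
Proof.
move=> h; elim: h i j => [|v w t _ IH _ vw nt]; first by move=> i [|j] //; rewrite andbF.
move=> [|i] [|j] //; last exact: IH.
case: j => [|j] /=; rewrite ?vw // !ltnS => jt.
by apply: negbTE; apply: nt; apply: mem_nth.
Qed.

(* Every vertex of a chain from the third one on separates its predecessor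
   from all earlier vertices. *)
Inductive chain a x : seq V -> Prop :=
  | ChainL : chain a x [:: x; a]
  | ChainR : chain a x [:: a; x]
  | ChainS v w u t of chain a x [:: w, u & t] & v \notin [:: w, u & t] &
      {in u :: t, forall z, G v z = ~~ G v w} : chain a x [:: v, w, u & t].

Lemma chain_mem a x s : chain a x s -> a \in s /\ x \in s.
Proof.
elim=> [||v w u t _ [ha hx] _ _]; last by rewrite in_cons ha orbT in_cons hx orbT.
  by rewrite !inE !eqxx orbT.
by rewrite !inE !eqxx orbT.
Qed.

Lemma chain_uniq a x s : a != x -> chain a x s -> uniq s.
Proof.
move=> ax; elim=> [||v w u t _ us nv _]; last by rewrite cons_uniq nv.
  by rewrite /= inE eq_sym ax.
by rewrite /= inE ax.
Qed.

(** The chain is truncated at [v]; reaching its very first vertex requires exchanging the two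
    starting vertices, hence the two base constructors. *)
Lemma chain_reach a x s v : chain a x s -> v \in s -> exists t, chain a x (v :: t).
Proof.
move=> h; elim: h v => [||v' w u t cs IH nv h] v.
- by rewrite !inE => /orP[]/eqP->; eexists; [exact: ChainL | exact: ChainR].
- by rewrite !inE => /orP[]/eqP->; eexists; [exact: ChainR | exact: ChainL].
by rewrite inE => /orP[/eqP->|/IH//]; exists [:: w, u & t]; apply: ChainS.
Qed.

(** The chain is truncated at the earliest vertex that [v] distinguishes from [a]; all vertices
    before it look to [v] like [a]. *)
Lemma chain_extend a x s v : chain a x s -> v \notin s -> G v a = G v x ->
  has (fun r => G v r != G v a) s -> exists t, chain a x (v :: t).
Proof.
move=> h; elim: h v => [||v' w u t cs IH nv h] v nvs vax.
- by rewrite /= vax eqxx.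
- by rewrite /= vax eqxx.
have [hs|] := boolP (has (fun r => G v r != G v a) [:: w, u & t]).
  by move=> _; apply: IH => //; move: nvs; rewrite inE negb_or => /andP[].
move=> /hasPn nh; have nh' r : r \in [:: w, u & t] -> G v r = G v a.
  by move=> /nh; rewrite negbK => /eqP.
rewrite -cat1s has_cat => /orP[|/hasP[r /nh /negP//]]; rewrite /= orbF => v'a.
exists [:: v', w, u & t]; apply: ChainS => //; first exact: ChainS.
move=> z /nh' ->; move: v'a; by case: (G v v'); case: (G v a).
Qed.

Lemma chain_to a x : indec G [set: V] -> a != x -> forall v, exists t, chain a x (v :: t).
Proof.
move=> iG ax.
suff grow (R : {set V}) : a \in R -> x \in R ->
    (forall v, v \in R -> exists t, chain a x (v :: t)) ->
    forall v, exists t, chain a x (v :: t).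
  apply: (grow [set a; x]); rewrite ?inE ?eqxx ?orbT // => v.
  by rewrite !inE => /orP[]/eqP->; eexists; [exact: ChainR | exact: ChainL].
(* [R] consists of vertices known to head a chain. Unless it is everything it is not an interval, so
   some [v] outside distinguishes [a] from a member of [R], and [v] heads a chain as well. *)
have [n] := ubnP #|~: R|; elim: n R => // n IHn R ltRn aR xR reach.
have [intR|] := boolP (intv G [set: V] R).
  by move=> v; apply/reach/(indecT_full iG intR aR xR ax).
move=> nR; have [v vR [r rR vr]] : exists2 v, v \notin R & exists2 r, r \in R & G v r != G v a.
  case/forall_inPn: nR => v; rewrite inE => /andP[vR _] /forall_inPn[y].
  rewrite inE => /andP[_ yR] /forall_inPn[z]; rewrite inE => /andP[_ zR] yz.
  exists v => //; case: (eqVneq (G v y) (G v a)) => [ya|]; last by exists y.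
  by exists z => //; rewrite -ya eq_sym.
have va : v != a by apply: contraNneq vR => ->.
have vx : v != x by apply: contraNneq vR => ->.
have reach_v : exists t, chain a x (v :: t).
  have [vax|nvax] := eqVneq (G v a) (G v x); last first.
    exists [:: x; a]; apply: ChainS; first exact: ChainL.
      by rewrite !inE negb_or vx.
    by move=> z; rewrite inE => /eqP->; move: nvax; case: (G v a); case: (G v x).
  have [t ct] := reach r rR.
  have [vt|nvt] := boolP (v \in r :: t); first exact: chain_reach ct vt.
  by apply: chain_extend ct nvt vax _; rewrite /= vr.
apply: (IHn (v |: R)); rewrite ?inE ?aR ?xR ?orbT //.
  by move: ltRn; rewrite (cardsD1 v (~: R)) inE vR setCU setDE setIC add1n ltnS.
by move=> z; rewrite !inE => /orP[/eqP->//|/reach].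
Qed.

Lemma chain_path a x s : G a x -> chain a x s -> {in s, forall v,
  exists2 t, induced_path a (v :: t) & {subset v :: t <= s}}.
Proof.
move=> ax h.
have base s' : s' =i [:: x; a] -> {in s', forall v,
    exists2 t, induced_path a (v :: t) & {subset v :: t <= s'}}.
  move=> es v; rewrite es !inE => /orP[]/eqP->.
    exists [:: a]; last by move=> z; rewrite es.
    apply: InducedPathS => //; first exact: InducedPath1.
      by rewrite inE; apply: contraTneq ax => ->; rewrite adj_irr.
    by rewrite adj_sym.
  exists [::]; first exact: InducedPath1.
  by move=> z; rewrite es !inE => ->; rewrite orbT.
elim: h => [||v w u t cs IH nv h]; [exact: base | |].
  by apply: base => z; rewrite !inE orbC.
move=> v'; rewrite inE => /orP[/eqP->|/IH[t' pt' st']]; last first.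
  by exists t' => // z /st' zt; rewrite inE zt orbT.
(* Since [v] separates [w] from all earlier vertices, it is adjacent to [w] or to all the others. *)
have [r rs vr] : exists2 r, r \in [:: w, u & t] & G v r.
  case vw: (G v w); first by exists w; rewrite // mem_head.
  by exists u; rewrite ?(h u (mem_head _ _)) ?vw // !inE eqxx orbT.
have [t' pt' st'] := IH r rs.
have [||t'' pt'' st''] := induced_path_extend (v := v) pt'.
- by apply: contra nv => /st'.
- by rewrite /= vr.
exists t'' => // z; rewrite inE => /orP[/eqP->|/st''/st' zs]; first exact: mem_head.
by rewrite inE zs orbT.
Qed.

(** Position [i] carries the label [i.+1]; [z] is merely the default value of [nth]. *)
Definition realizes (R : rel nat) s z :=
  uniq s /\ forall i j, i < size s -> j < size s ->
    G (nth z s i) (nth z s j) = R i.+1 j.+1.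

Lemma realizes_rev (R : rel nat) s z : symmetric R -> irreflexive R -> uniq s ->
  (forall i j, i < j < size s ->
     G (nth z s i) (nth z s j) = R (size s - i) (size s - j)) ->
  realizes R (rev s) z.
Proof.
move=> Rs Ri us h; split; first by rewrite rev_uniq.
rewrite size_rev => i j ltis ltjs; rewrite !nth_rev //.
case: (ltngtP i j) => ij.
- rewrite adj_sym h; last by lia.
  by rewrite Rs; congr (R _ _); lia.
- rewrite h; last by lia.
  by congr (R _ _); lia.
- by rewrite ij adj_irr Ri.
Qed.

Lemma Q_adj_sym n : symmetric (Q_adj n).
Proof.
move=> i j; rewrite /Q_adj /path_adj andbCA.
by congr (_ || _); rewrite orbC.
Qed.

Lemma path_adj_irr : irreflexive path_adj.
Proof. by move=> i; rewrite /path_adj; lia. Qed.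

Lemma Q_adj_irr n : irreflexive (Q_adj n).
Proof.
by move=> i; rewrite /Q_adj path_adj_irr !andbF orbb /= !inE; case: eqP.
Qed.

Lemma path_adj_sub m i j : i < j < m -> path_adj (m - i) (m - j) = (j == i.+1).
Proof. by rewrite /path_adj; lia. Qed.

(** In a backward list position [i] carries the label [m - i]: the head sees only position 1, and
    position 1 misses only position 2 among the later ones. *)
Lemma Q_adj_sub m i j : i < j < m -> Q_adj m (m - i) (m - j) =
  match i with 0 => j == 1 | 1 => 2 < j | _ => j == i.+1 end.
Proof.
move=> ij; rewrite /Q_adj /path_adj !inE.
by case: i ij => [|[|i]] ij; lia.
Qed.

Lemma spanning_path_or_Q a b x : indec G [set: V] -> a != b -> ~~ G a b ->
  G a x -> ~~ G b x ->
  exists s, [/\ 4 <= size s, nth a s 0 = a, nth a s (size s).-1 = b &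
    realizes path_adj s a \/ realizes (Q_adj (size s)) s a].
Proof.
move=> iG ab nab ax nbx.
have nax : a != x by apply: contraTneq ax => ->; rewrite adj_irr.
have nxb : b != x by apply: contraNneq nab => ->.
have nba : ~~ G b a by rewrite adj_sym.
suff [s [s4 sb sa hs]] : exists s, [/\ 4 <= size s, head a s = b, last a s = a &
    realizes path_adj (rev s) a \/ realizes (Q_adj (size s)) (rev s) a].
  exists (rev s); rewrite size_rev; split=> //.
    by rewrite nth_rev ?subn1 ?nth_last //; lia.
  by rewrite nth_rev ?prednK ?subnn ?nth0 //; lia.
have [t ct] := chain_to iG nax b.
have [c [d [t' [ct' bt' hb]]]] : exists c d t', [/\ chain a x [:: c, d & t'],
    b \notin [:: c, d & t'] & {in d :: t', forall z, G b z = ~~ G b c}].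
  inversion ct as [[eb et]|[eb et]|v w u t' ct' nv h [ev et]].
  - by rewrite eb eqxx in nxb.
  - by rewrite eb eqxx in ab.
  - by exists w, u, t'.
have [at' xt'] := chain_mem ct'.
(* [b] misses both [a] and [x], at least one of which precedes [c]; as [b] separates [c] from all
   earlier vertices, it sees [c] and none of those. *)
have bc : G b c.
  apply: contraTT isT => nbc; move: xt'; rewrite inE => /orP[/eqP xc|xt'].
    move: at'; rewrite inE -xc (negPf nax) /= => at'.
    by have := hb a at'; rewrite (negPf nbc) (negPf nba).
  by have := hb x xt'; rewrite (negPf nbc) (negPf nbx).
have {}hb z : z \in d :: t' -> ~~ G b z by move=> /hb ->; rewrite bc.
have ca : c != a by apply: contraTneq bc => ->.
have cx : c != x by apply: contraTneq bc => ->.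
have {at'}at' : a \in d :: t' by move: at'; rewrite inE eq_sym (negPf ca).
have {xt'}xt' : x \in d :: t' by move: xt'; rewrite inE eq_sym (negPf cx).
(* If [c] misses [a], an induced path from [a] to [c] in the chain continues to [b]. Otherwise [c]
   and [b] receive the labels [m - 1] and [m] of [Q_m]. *)
have [Gca|nca] := boolP (G c a); last first.
  have [p pp sp] := chain_path ax ct' (mem_head _ _).
  have pcb z : z \in p -> z \in d :: t'.
    move=> zp; have := sp z; rewrite !inE zp orbT => /(_ isT) /orP[/eqP zc|//].
    by have := induced_path_uniq pp; rewrite /= -zc zp.
  have pb : induced_path a [:: b, c & p].
    apply: InducedPathS => //; first by apply: contra bt' => /sp.
    by move=> z /pcb /hb.
  exists [:: b, c & p]; split=> //.
  - have lp := induced_path_last a pp; case: p pp lp {sp pcb pb} => [|u [|w p]] //= pp lp.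
      by rewrite lp eqxx in ca.
    by have := induced_path_nth a pp (i := 0) (j := 1) isT; rewrite /= lp (negPf nca).
  - exact: (induced_path_last a pb).
  left; apply: realizes_rev => [i j||| i j ij].
  - by rewrite /path_adj orbC.
  - exact: path_adj_irr.
  - exact: induced_path_uniq pb.
  - by rewrite (induced_path_nth _ pb ij) path_adj_sub.
(* In general [d'] is [d], the only earlier vertex that [c] misses. If [d] is [a], then [c] misses
   [x], and the edge from [a] to [x] serves as the path, giving [Q_4]. *)
have [d' [p [pp sp da cd cp]]] : exists d' p, [/\ induced_path a (d' :: p),
    {subset d' :: p <= d :: t'}, d' != a, ~~ G c d' & {in p, forall z, G c z}].
  inversion ct' as [[ec et]|[ec et]|v w u t'' ct'' nv h [ev ew et]]; last subst t'.
  - by rewrite ec eqxx in cx.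
  - by rewrite ec eqxx in ca.
  have nd z : z \in [:: d, u & t''] -> z != d -> G c z = ~~ G c d.
    by rewrite inE => /orP[/eqP->|zt _]; [rewrite eqxx | apply: h].
  have [da|da] := eqVneq d a.
    exists x, [:: a]; split.
    - apply: InducedPathS; rewrite ?inE 1?eq_sym // 1?adj_sym //; exact: InducedPath1.
    - by move=> z; rewrite in_cons mem_seq1 => /orP[]/eqP->.
    - by rewrite eq_sym.
    - by rewrite (nd x) // ?da 1?eq_sym // Gca.
    - by move=> z; rewrite inE => /eqP->.
  have cd : G c d = false by apply: negbTE; rewrite -(nd a) // eq_sym.
  have [p pp sp] := chain_path ax ct'' (mem_head _ _).
  exists d, p; split=> //; first by rewrite cd.
  move=> z zp; rewrite nd ?cd //; first by apply: sp; rewrite inE zp orbT.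
  by apply: contraTneq zp => ->; case/andP: (induced_path_uniq pp).
have ne : 0 < size p.
  by case: p pp {sp cp} => // /(induced_path_last a) /= d'a; rewrite d'a eqxx in da.
exists [:: b, c, d' & p]; split=> //=; first exact: (induced_path_last a pp).
right; apply: realizes_rev => [|||i j ij].
- exact: Q_adj_sym.
- exact: Q_adj_irr.
- have sp' z : z \in d' :: p -> z \in [:: c, d & t'] by move=> /sp zt; rewrite inE zt orbT.
  have uc := chain_uniq nax ct'.
  rewrite cons_uniq cons_uniq (induced_path_uniq pp) andbT; apply/andP; split.
    apply: contra bt'; rewrite inE => /orP[/eqP->|/sp'//]; exact: mem_head.
  by apply/negP=> /sp ct2; case/andP: uc => /negP.
rewrite Q_adj_sub //; have := @induced_path_nth a (d' :: p) a i.-2 j.-2 pp.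
have mem k : k.+2 < (size p).+3 -> nth a (d' :: p) k \in d :: t'.
  by move=> kp; apply/sp/mem_nth.
have cp' k : k.+3 < (size p).+3 -> G c (nth a p k) by move=> kp; apply/cp/mem_nth.
case: i j ij => [|[|i]] [|[|[|j]]] //= ij.
- by move=> _; apply/negbTE/hb/(mem 0).
- by move=> _; apply/negbTE/hb/(mem j.+1).
- by move=> _; apply/negbTE.
- by move=> _; rewrite cp'.
by move=> h; exact: h ij.
Qed.

End Chains.

(** * Indecomposability of [P_m] and [Q_m] by arithmetic on labels *)

Section LabelledIntervals.
Variables (R : rel nat) (m : nat) (J : pred nat).
Hypothesis interval_J : forall i j k, 0 < i <= m -> 0 < j <= m -> 0 < k <= m ->
  ~~ J i -> J j -> J k -> R i j = R i k.

Lemma interval_sep i j k : 0 < i <= m -> 0 < j <= m -> 0 < k <= m ->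
  J j -> J k -> R i j != R i k -> J i.
Proof. by move=> im jm km Jj Jk; apply: contraR => nJi; apply/eqP/interval_J. Qed.

(** The premise, true of both [P_m] and [Q_m], says that a label separates its predecessor from all
    smaller ones; so labels enter [J] one after the other. *)
Lemma interval_up :
  (forall i j, 0 < i < j -> j < m -> R j.+1 i != R j.+1 j) ->
  forall i j k, 0 < i < j -> j <= k <= m -> J i -> J j -> J k.
Proof.
move=> step i j k ij; elim: k => [|k IH]; first by lia.
move=> jk Ji Jj; have [<-//|ne] := eqVneq j k.+1.
have Jk : J k by apply: IH => //; lia.
apply: (@interval_sep _ i k); rewrite ?step //; lia.
Qed.

End LabelledIntervals.

Lemma path_adj_interval m (J : pred nat) p q i :
  (forall i j k, 0 < i <= m -> 0 < j <= m -> 0 < k <= m ->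
     ~~ J i -> J j -> J k -> path_adj i j = path_adj i k) ->
  3 < m -> 0 < p < q -> q <= m -> J p -> J q -> 0 < i <= m -> J i.
Proof.
move=> iJ m4 pq qm Jp Jq im.
have sep := interval_sep iJ.
have up : forall i j k, 0 < i < j -> j <= k <= m -> J i -> J j -> J k.
  by apply: (interval_up iJ) => *; rewrite /path_adj; lia.
have Jm : J m by apply: (up p q) => //; lia.
(* With [m] as second member, each label below [p] is forced in turn: it separates its successor
   from [m]. *)
have J1 : J 1.
  have h : forall k, k < p -> J (p - k).
    elim=> [|k IH] kp; first by rewrite subn0.
    apply: (sep _ (p - k) m) => //; rewrite ?IH //; try lia.
    by rewrite /path_adj; lia.
  have e1 : p - p.-1 = 1 by lia.
  by rewrite -e1; apply: h; lia.
have J2 : J 2 by apply: (sep _ 1 m); rewrite /path_adj //; lia.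
have [->//|i1] := eqVneq i 1.
by apply: (up 1 2); lia.
Qed.

Lemma Q_adj_interval m (J : pred nat) p q i :
  (forall i j k, 0 < i <= m -> 0 < j <= m -> 0 < k <= m ->
     ~~ J i -> J j -> J k -> Q_adj m i j = Q_adj m i k) ->
  3 < m -> 0 < p < q -> q <= m -> J p -> J q -> 0 < i <= m -> J i.
Proof.
move=> iJ m4 pq qm Jp Jq im.
have sep := interval_sep iJ.
have up : forall i j k, 0 < i < j -> j <= k <= m -> J i -> J j -> J k.
  by apply: (interval_up iJ) => *; rewrite /Q_adj /path_adj !inE; lia.
(* Two members below [m] force [m - 1] and [m]. Every label up to [m - 3] separates these two, and
   [m - 2] separates [m - 3] from [m]. *)
have base j k : 0 < j < k -> k < m -> J j -> J k -> J i.
  move=> jk km Jj Jk.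
  have Jm : J m by apply: (up j k) => //; lia.
  have Jm1 : J m.-1 by apply: (up j k) => //; lia.
  have low l : 0 < l <= m - 3 -> J l.
    move=> lm; apply: (sep _ m.-1 m) => //; try lia.
    by rewrite /Q_adj /path_adj !inE; lia.
  have Jm2 : J (m - 2).
    apply: (sep _ (m - 3) m) => //; try lia; first by apply: low; lia.
    by rewrite /Q_adj /path_adj !inE; lia.
  have [->//|im'] := eqVneq i m; have [->//|im1] := eqVneq i m.-1.
  have [->//|im2] := eqVneq i (m - 2); apply: low; lia.
(* If [q] is [m], labels separating [p] from [m] yield further members below [m], and [base]
   applies. *)
have [qm'|qm'] := ltnP q m; first exact: (base p q).
have {qm'} qm' : q = m by lia.
subst q.
have [pm1|pm1] := eqVneq p m.-1.
  have low l : 0 < l <= m - 3 -> J l.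
    move=> lm; apply: (sep _ p m) => //; try lia.
    by rewrite /Q_adj /path_adj !inE; lia.
  have Jm2 : J (m - 2).
    apply: (sep _ (m - 3) m) => //; try lia; first by apply: low; lia.
    by rewrite /Q_adj /path_adj !inE; lia.
  by apply: (base (m - 2) p) => //; lia.
have [pm2|pm2] := eqVneq p (m - 2).
  apply: (base (m - 3) (m - 2)); try lia; rewrite -?pm2 //.
  apply: (sep _ p m) => //; try lia.
  by rewrite /Q_adj /path_adj !inE; lia.
apply: (base p p.+1) => //; try lia.
apply: (sep _ p m) => //; try lia.
by rewrite /Q_adj /path_adj !inE; lia.
Qed.

Lemma indec_labelled m (R : rel nat) (H : rel 'I_m) :
  (forall (J : pred nat) p q i,
    (forall i j k, 0 < i <= m -> 0 < j <= m -> 0 < k <= m ->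
       ~~ J i -> J j -> J k -> R i j = R i k) ->
    0 < p < q -> q <= m -> J p -> J q -> 0 < i <= m -> J i) ->
  (forall i j : 'I_m, H i j = R i.+1 j.+1) -> indec H [set: 'I_m].
Proof.
move=> nat_interval HR; apply/indecP => I y z /intvP hI _ yI _ zI yz.
pose J l := [exists i : 'I_m, (i.+1 == l) && (i \in I)].
have JE (i : 'I_m) : J i.+1 = (i \in I).
  apply/existsP/idP => [[i' /andP[/eqP[/val_inj->]]] //|iI].
  by exists i; rewrite eqxx.
have JP l : 0 < l <= m -> exists2 i : 'I_m, l = i.+1 & J l = (i \in I).
  case: l => // l lm; have lt : l < m by lia.
  by exists (Ordinal lt) => //; rewrite -JE.
have iJ i j k : 0 < i <= m -> 0 < j <= m -> 0 < k <= m ->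
    ~~ J i -> J j -> J k -> R i j = R i k.
  move=> /JP[i' -> ->] /JP[j' -> ->] /JP[k' -> ->] i'I j'I k'I.
  by rewrite -!HR; apply: hI; rewrite ?inE.
apply/subsetP => i _; rewrite -JE.
case: (ltngtP y z) => yz'.
- by apply: (nat_interval J y.+1 z.+1); rewrite ?JE //=; have := ltn_ord z; have := ltn_ord i; lia.
- by apply: (nat_interval J z.+1 y.+1); rewrite ?JE //=; have := ltn_ord y; have := ltn_ord i; lia.
- by case/eqP: yz; apply: val_inj.
Qed.

Lemma indec_realizes (V : finType) (G : sgraph V) (R : rel nat) s z :
  R = path_adj \/ R = Q_adj (size s) -> 3 < size s -> realizes G R s z ->
  indec G [set x in s].
Proof.
move=> hR s4 [us hs]; pose f (i : 'I_(size s)) := nth z s i.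
have -> : [set x in s] = f @: [set: 'I_(size s)].
  apply/setP => x; rewrite inE; apply/idP/imsetP => [xs|[i _ ->]]; last exact: mem_nth.
  have lt : index x s < size s by rewrite index_mem.
  by exists (Ordinal lt); rewrite // /f /= nth_index.
apply: (@indec_image _ _ (fun i j : 'I_(size s) => R i.+1 j.+1) _ false).
- by move=> i j _ _ /eqP; rewrite nth_uniq // => /eqP/val_inj.
- by move=> i j _ _ _; apply: hs.
apply: (@indec_labelled _ R) => // J p q i iJ.
by case: hR => hR; subst R; [apply: path_adj_interval | apply: Q_adj_interval].
Qed.

(** * Translation between vertex subsets and the graph definitions *)

Lemma indecomposableE (V : finType) (G : sgraph V) :
  indecomposable G = indec G [set: V].
Proof.
apply: eq_forallb => I; congr (_ ==> _).
  apply/forall_inP/intvP => [h x y z _ xI _ yI _ zI|h x xI].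
    by have /orP[] := h x xI => /forall_inP hx; rewrite ?hx // (negPf (hx y yI)) (negPf (hx z zI)).
  have [I0|[y yI]] := set_0Vmem I.
    by apply/orP; left; apply/forall_inP => y; rewrite I0 inE.
  case xy: (G x y); apply/orP; [left | right]; apply/forall_inP => z zI.
    by rewrite (h x z y) ?inE.
  by rewrite (h x z y) ?inE ?xy.
rewrite /trivial_interval setTI subTset orbA orbAC; congr (_ || _).
rewrite leq_eqVlt ltnS leqn0 cards_eq0 orbC; congr (_ || _).
by apply/existsP/cards1P => [[x /eqP]|[x ->]]; exists x.
Qed.

Lemma induced_indec (V : finType) (G : sgraph V) (X : {set V}) :
  indecomposable (induced G X) = indec G X.
Proof.
rewrite indecomposableE; apply/idP/idP => iX.
  have -> : X = val @: [set: {x | x \in X}].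
    apply/setP => x; apply/idP/imsetP => [xX|[u _ ->]]; last exact: valP.
    by exists (Sub x xX).
  by apply: (indec_image (c := false)) iX => // x y _ _; apply: val_inj.
have [X0|[x0 x0X]] := set_0Vmem X.
  by apply/indecP => I [y yX]; have := in_set0 y; rewrite -X0 yX.
pose f x : {x | x \in X} := insubd (Sub x0 x0X) x.
have fK x : x \in X -> val (f x) = x by move=> xX; rewrite /f val_insubd xX.
have -> : [set: {x | x \in X}] = f @: X.
  apply/esym/setP => u; rewrite inE; apply/imsetP; exists (val u); first exact: valP.
  exact/esym/val_inj/fK/valP.
apply: (indec_image (c := false)) iX => [x y xX yX fxy|x y xX yX _].
  by rewrite -(fK x xX) fxy fK.
by rewrite /induced /= /pullback_rel !fK.
Qed.

Lemma indec_complement (V : finType) (G : sgraph V) (X : {set V}) :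
  indec (complement G) X = indec G X.
Proof.
have im : X = id @: X by rewrite imset_id.
apply/idP/idP => iX; rewrite im; apply: (indec_image (c := true)) iX => //= x y _ _ xy.
  by rewrite /compl_rel xy negbK.
by rewrite /compl_rel xy.
Qed.

(* The isomorphism onto ['I_#|V|] sends [s] to the first labels; the vertices
   outside [s] come last, in arbitrary order. *)
Lemma labelling (V : finType) (G : sgraph V) (a b : V) (s : seq V) :
  indec G [set: V] -> uniq s -> 0 < size s -> nth a s 0 = a -> nth a s (size s).-1 = b ->
  (forall X : {set V}, a \in X -> b \in X -> #|X| = #|V| - 2 -> ~~ indec G X) ->
  exists (H : sgraph 'I_#|V|) (f : V -> 'I_#|V|),
    [/\ isomorphism G H f, indecomposable H,
        covered (indec_graph H) (labelled #|V| [:: 1; size s]),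
        f @: [set a; b] = labelled #|V| [:: 1; size s] &
        forall i j : 'I_#|V|, i < size s -> j < size s -> H i j = G (nth a s i) (nth a s j)].
Proof.
move=> iG us s1 sa sb no.
pose l := s ++ [seq x <- enum V | x \notin s].
have ul : uniq l.
  rewrite cat_uniq us filter_uniq ?enum_uniq // andbT.
  by apply/hasPn => x; rewrite mem_filter => /andP[].
have memls x : x \in l by rewrite mem_cat mem_filter mem_enum andbT orbN.
have szl : size l = #|V|.
  by rewrite -(card_uniqP ul); apply: eq_card => x; rewrite memls.
have lt x : index x l < #|V| by rewrite -szl index_mem.
pose f x := Ordinal (lt x); pose g (i : 'I_#|V|) := nth a l i.
have fK : cancel f g by move=> x; rewrite /g /= nth_index.
have gK : cancel g f by move=> i; apply: val_inj; rewrite /= index_uniq // szl.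
have gs (i : 'I_#|V|) : i < size s -> g i = nth a s i by move=> is_; rewrite /g nth_cat is_.
pose H := pullback g G.
have HE x y : H (f x) (f y) = G x y by rewrite /H /= /pullback_rel !fK.
have szV : size s <= #|V| by rewrite -szl size_cat leq_addr.
have lt0 : 0 < #|V| by lia.
have lt1 : (size s).-1 < #|V| by lia.
(* Labels start at 1: [i0] has label 1 and [i1] has label [size s]. *)
pose i0 := Ordinal lt0; pose i1 := Ordinal lt1.
have gi0 : g i0 = a by rewrite gs.
have gi1 : g i1 = b by rewrite gs //=; lia.
have labE : labelled #|V| [:: 1; size s] = [set i0; i1].
  apply/setP => i; rewrite !inE /label -!val_eqE /= eqSS; congr (_ || _).
  by rewrite -[in LHS](prednK s1) eqSS.
exists H, f; split.
- by split; first by exists g.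
- rewrite indecomposableE.
  have -> : [set: 'I_#|V|] = f @: [set: V].
    by apply/esym/setP => i; rewrite inE -(gK i) imset_f.
  apply: (indec_image (c := false)) iG => [x y _ _|x y _ _ _]; last by rewrite HE.
  exact: (can_inj fK).
(* An edge avoiding [i0] and [i1] would pull back to an indecomposable set excluded by [no]. *)
- apply/forallP => x; apply/forallP => y; apply/implyP.
  case/andP=> xy; rewrite induced_indec labE => iH.
  apply: contraT; rewrite negb_or => /andP[xl yl].
  have gH : indec G (g @: ~: [set x; y]).
    apply: (indec_image (c := false)) iH => [i j _ _|i j _ _ _] //.
    exact: (can_inj gK).
  move: gH; rewrite (negPf (no _ _ _ _)) //.
  + by rewrite -gi0 imset_f // inE; move: xl yl; rewrite !inE !negb_or ![i0 == _]eq_sym => /andP[-> _] /andP[-> _].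
  + by rewrite -gi1 imset_f // inE; move: xl yl; rewrite !inE !negb_or ![i1 == _]eq_sym => /andP[_ ->] /andP[_ ->].
  + rewrite card_imset; last exact: (can_inj gK).
    have h := cardsC [set x; y]; rewrite cards2 xy card_ord in h.
    by rewrite -[X in _ = X - 2]h addKn.
- by rewrite labE imsetU1 imset_set1 -gi0 -gi1 !gK.
- by move=> i j is_ js; rewrite /H /= /pullback_rel !gs.
Qed.

(** * Recognition of the classes and reduction to a nonadjacent pair *)

Lemma labelled_case (V : finType) (G : sgraph V) (a b x : V) :
  14 <= #|V| -> indec G [set: V] -> a != b -> ~~ G a b -> G a x -> ~~ G b x ->
  (forall X : {set V}, a \in X -> b \in X -> #|X| = #|V| - 2 -> ~~ indec G X) ->
  exists k (H : sgraph 'I_#|V|) (f : V -> 'I_#|V|),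
    [/\ k = 0 /\ (class_P H \/ class_Q H) \/
        k \in [:: 1; 3; 5] /\ (class_P_minus k H \/ class_Q_minus k H),
        isomorphism G H f & f @: [set a; b] = labelled #|V| [:: 1; #|V| - k]].
Proof.
move=> n14 iG ab nab ax nbx no.
have [s [s4 sa sb hs]] := spanning_path_or_Q iG ab nab ax nbx.
have s0 : 0 < size s := leq_trans (isT : 0 < 4) s4.
have us : uniq s by case: hs => -[].
have iS : indec G [set y in s] by case: hs => hs; apply: (indec_realizes _ _ hs); auto.
have cS : #|[set y in s]| = size s by rewrite cardsE (card_uniqP us).
have cC : #|~: [set y in s]| = #|V| - size s by have := cardsC [set y in s]; lia.
have sn : size s <= #|V| by rewrite -cS max_card.
have aS : a \in [set y in s] by rewrite inE -[X in X \in _]sa; apply: mem_nth.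
have bS : b \in [set y in s] by rewrite inE -[X in X \in _]sb; apply: mem_nth; rewrite prednK.
(* Any other codimension is even and positive or odd and at least 7, so [indec_codim2] contradicts
   [no]. *)
have hk : #|V| - size s \in [:: 0; 1; 3; 5].
  apply: contraT => hk.
  have [||Y [/subsetP SY iY cY]] := @indec_codim2 _ G (@adj_sym _ G) _ iG iS; rewrite ?cC ?cS.
  - exact: leq_trans s4.
  - by move: hk; case: (#|V| - size s) => [|[|[|[|[|[|[|m]]]]]]] //; case: ifP.
  have : ~~ indec G Y by apply: no; rewrite ?SY // -[#|V|](cardsC Y) cY addnK.
  by rewrite iY.
have [H [f [isof iH cH fab HG]]] := labelling iG us s0 sa sb no.
have em : #|V| - (#|V| - size s) = size s := subKn sn.
(* No size threshold of the classes exceeds 14. *)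
have large k : k <= 14 -> k <= #|V| by move=> k14; apply: leq_trans n14.
exists (#|V| - size s), H, f; rewrite em.
split=> //; have [k0|k0] := eqVneq (#|V| - size s) 0.
  left; split=> //; have en : size s = #|V|.
    by apply/eqP; rewrite eqn_leq sn -subn_eq0 k0.
  have ins (i : 'I_#|V|) : i < size s by rewrite en.
  case: hs => -[_ hs]; [left | right]; split; rewrite ?large // => i j;
    by rewrite HG ?hs ?ins //= /Q_rel ?en.
right; move: hk; rewrite inE (negPf k0) /= => hk; split=> //.
have ins (i : 'I_(#|V| - (#|V| - size s))) : i < size s by rewrite -[X in _ < X]em.
have HW (i j : 'I_(#|V| - (#|V| - size s))) :
    delete_last (#|V| - size s) H i j = G (nth a s i) (nth a s j).
  by apply: HG; apply: ins.
case: hs => -[_ hs]; [left | right]; split; rewrite ?em //.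
- by move: hk; rewrite !inE => /or3P[]/eqP->; apply: large.
- by move=> i j; rewrite HW hs ?ins.
- by move: hk; rewrite !inE => /or3P[]/eqP->; apply: large.
- by move=> i j; rewrite HW hs ?ins //=; congr (Q_adj _ _ _).
Qed.

Theorem corollary1p9 (V : finType) (G : sgraph V)
    (hG : indecomposable G) (hn : 14 <= #|V|) (a b : V) (hab : a != b) :
  [\/ exists X : {set V},
        [/\ a \in X, b \in X, #|X| = #|V| - 2 & indecomposable (induced G X)],
      exists (H : sgraph 'I_#|V|) (f : V -> 'I_#|V|),
        [/\ class_P H \/ class_Q H,
            isomorphism G H f \/ isomorphism (complement G) H f &
            f @: [set a; b] = labelled #|V| [:: 1; #|V|]]
    | exists (k : nat) (H : sgraph 'I_#|V|) (f : V -> 'I_#|V|),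
        [/\ k \in [:: 1; 3; 5],
            class_P_minus k H \/ class_Q_minus k H,
            isomorphism G H f \/ isomorphism (complement G) H f &
            f @: [set a; b] = labelled #|V| [:: 1; #|V| - k]]].
Proof.
have [/existsP[X /and4P[aX bX /eqP cX iX]]|] :=
  boolP [exists X : {set V}, [&& a \in X, b \in X, #|X| == #|V| - 2 & indec G X]].
  by apply: Or31; exists X; rewrite induced_indec.
rewrite negb_exists => /forallP no0.
have no (X : {set V}) : a \in X -> b \in X -> #|X| = #|V| - 2 -> ~~ indec G X.
  by move=> aX bX cX; have := no0 X; rewrite aX bX cX eqxx.
have {}hG : indec G [set: V] by rewrite -indecomposableE.
have [G' [iG' GG' nab']] : exists G' : sgraph V,
    [/\ forall X, indec G' X = indec G X, G' = G \/ G' = complement G & ~~ G' a b].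
  case ab: (G a b); last by exists G; split; auto; rewrite ab.
  exists (complement G); split; [exact: indec_complement | by right |].
  by rewrite /= /compl_rel ab andbF.
have [x nx] : exists x, [&& x != a, x != b & G' x a != G' x b].
  have [x _ /andP[xa xb]] := @card3_third _ [set: V] a b ltac:(by rewrite cardsT; lia).
  apply/existsP; apply: contraT; rewrite negb_exists => /forallP nodist.
  case: (@indec_no_twins _ G' [set: V] a b _ _ _ _ hab); rewrite ?inE ?iG' ?cardsT //; first by lia.
  by move=> v _ va vb; have := nodist v; rewrite va vb negbK => /eqP.
(* The conclusion involves only the set [{a, b}], so the two may be exchanged to make [x] adjacent
   to the first. *)
have {nx} [c [d [cd_ab cd ncd cx ndx]]] : exists c d,
    [/\ [set c; d] = [set a; b], c != d, ~~ G' c d, G' c x & ~~ G' d x].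
  case/and3P: nx => _ _; rewrite ![G' x _]adj_sym.
  case ax: (G' a x); case bx: (G' b x) => // _.
    by exists a, b; rewrite ax bx.
  by exists b, a; rewrite ax bx setUC eq_sym adj_sym.
have cd_no (X : {set V}) : c \in X -> d \in X -> #|X| = #|V| - 2 -> ~~ indec G' X.
  move=> cX dX; rewrite iG'; apply: no; apply: (subsetP (_ : [set a; b] \subset X));
    rewrite ?inE ?eqxx ?orbT // -cd_ab subUset !sub1set cX dX //.
have iG'T : indec G' [set: V] by rewrite iG'.
have [k [H [f [hk isof fab]]]] := labelled_case hn iG'T cd ncd cx ndx cd_no.
have iso : isomorphism G H f \/ isomorphism (complement G) H f.
  by case: GG' isof => ->; auto.
rewrite cd_ab in fab; case: hk => [[k0 hk]|[hk cls]].
  by apply: Or32; exists H, f; rewrite k0 subn0 in fab.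
by apply: Or33; exists k, H, f.
Qed.
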